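(* There exists a self-similar strongly local regular Dirichlet form $(\mathcal{E}_{\mathrm{loc}},\mathcal{F}_{\mathrm{loc}})$ on $L^2(K;\nu)$, where $K$ is the Sierpiński gasket with its normalized Hausdorff measure $\nu$, such that $$\mathcal{F}_{\mathrm{loc}}=\left\{u\in L^2(K;\nu):\ \sup_{n\ge1}\left(\tfrac{5}{3}\right)^n\sum_{w^{(1)}\sim_nw^{(2)}}\left(P_nu(w^{(1)})-P_nu(w^{(2)})\right)^2<+\infty\right\}$$ and $$\mathcal{E}_{\mathrm{loc}}(u,u)\asymp\sup_{n\ge1}\left(\tfrac{5}{3}\right)^n\sum_{w^{(1)}\sim_nw^{(2)}}\left(P_nu(w^{(1)})-P_nu(w^{(2)})\right)^2\quad\text{for all }u\in\mathcal{F}_{\mathrm{loc}},$$ where $\asymp$ means that each side is bounded by a positive constant, independent of $u$, times the other side.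
   Context: Let $p_0=(0,0)$, $p_1=(1,0)$, $p_2=(1/2,\sqrt3/2)\in\mathbb{R}^2$ and $f_i(x)=(x+p_i)/2$, $i=0,1,2$. The Sierpiński gasket $K$ is the unique non-empty compact set with $K=f_0(K)\cup f_1(K)\cup f_2(K)$; it carries the Euclidean metric. $\nu$ is the normalized (probability) Hausdorff measure on $K$ of dimension $\alpha=\log3/\log2$. For $n\ge1$, $W_n$ is the set of words $w=w_1\ldots w_n$ with $w_i\in\{0,1,2\}$; $f_w=f_{w_1}\circ\cdots\circ f_{w_n}$, $K_w=f_w(K)$. For $w^{(1)},w^{(2)}\in W_n$ write $w^{(1)}\sim_nw^{(2)}$ if $w^{(1)}\ne w^{(2)}$ and $K_{w^{(1)}}\cap K_{w^{(2)}}\neq\emptyset$; sums over $w^{(1)}\sim_nw^{(2)}$ run over ordered pairs. For $u\in L^2(K;\nu)$ and $w\in W_n$, $$P_nu(w)=\frac1{\nu(K_w)}\int_{K_w}u\,d\nu=\int_K (u\circ f_w)\,d\nu .$$ A Dirichlet form on $L^2(K;\nu)$ is a densely defined, non-negative definite, symmetric, closed, Markovian bilinear form. It is regular if $\mathcal{F}\cap C(K)$ is dense in $\mathcal{F}$ with respect to the norm $(\mathcal{E}(u,u)+\|u\|_{L^2}^2)^{1/2}$ and uniformly dense in $C(K)$. It is strongly local if $\mathcal{E}(u,v)=0$ for all $u,v\in\mathcal{F}$ with compact supports such that $v$ is constant in an open neighborhood of $\mathrm{supp}(u)$. A form $(\mathcal{E},\mathcal{F})$ on $L^2(K;\nu)$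 is self-similar if for all $u\in\mathcal{F}$ one has $u\circ f_i\in\mathcal{F}$ for $i=0,1,2$ and $\mathcal{E}(u,u)=\frac53\sum_{i=0}^2\mathcal{E}(u\circ f_i,u\circ f_i)$. *)

(* Defs.v *)
From HB Require Import structures.
From mathcomp Require Export all_boot all_order all_algebra.
From mathcomp Require Export all_classical all_reals all_analysis.

Set Implicit Arguments.
Unset Strict Implicit.
Unset Printing Implicit Defensive.

Export Order.TTheory GRing.Theory Num.Theory.
Export numFieldNormedType.Exports.

Local Open Scope classical_set_scope.
Local Open Scope ring_scope.

(* The library's norm on [R * R] is the sup norm, which induces the usual
   topology; the Euclidean metric needed for Hausdorff measures is [edist]. *)

Section Hausdorff.
Variable R : realType.
Implicit Types (A : set (R * R)) (x y : R * R).

Definition edist x y : R :=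
  Num.sqrt ((x.1 - y.1) ^+ 2 + (x.2 - y.2) ^+ 2).

(* The [maxe 0] only matters for [A = set0], whose diameter is 0. *)
Definition ediam A : \bar R :=
  maxe 0%E (ereal_sup [set (edist x y)%:E | x in A & y in A]).

Definition hausdorff_content (s delta : R) A : \bar R :=
  ereal_inf [set (\sum_(0 <= k <oo) (ediam (U k) `^ s))%E |
    U in [set U : nat -> set (R * R) |
      A `<=` \bigcup_k U k /\ forall k, (ediam (U k) <= delta%:E)%E]].

(* Hausdorff measure without a dimensional normalizing constant: that constant
   cancels in [normalized_hausdorff]. *)
Definition hausdorff (s : R) A : \bar R :=
  ereal_sup [set hausdorff_content s delta A | delta in [set d : R | 0 < d]].

(* Since [nu] has mass 1, this forces [hausdorff s K] to be neither 0 nor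
   [+oo]: in both cases the right-hand side would vanish for [A = setT]. *)
Definition normalized_hausdorff (s : R) (K : set (R * R))
    (nu : probability (R * R)%type R) : Prop :=
  forall A, measurable A ->
    nu A = (hausdorff s (A `&` K) * (fine (hausdorff s K))^-1%:E)%E.

End Hausdorff.

Section Gasket.
Variable R : realType.
Implicit Types (K : set (R * R)) (u : R * R -> R).

Definition gasket_pt (i : 'I_3) : R * R :=
  tnth [tuple (0, 0); (1, 0); (1 / 2, Num.sqrt 3 / 2)] i.

Definition gasket_map (i : 'I_3) (x : R * R) : R * R :=
  2^-1 *: (x + gasket_pt i).

(* These properties determine [K] uniquely. *)
Definition is_gasket K : Prop :=
  [/\ K !=set0, compact K & K = \bigcup_i (gasket_map i @` K)].

Definition gasket_dim : R := ln 3 / ln 2.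

Definition word_map (n : nat) (w : n.-tuple 'I_3) : R * R -> R * R :=
  foldr (fun i f => gasket_map i \o f) id w.

Definition cell K (n : nat) (w : n.-tuple 'I_3) : set (R * R) :=
  word_map w @` K.

Definition neighbor K (n : nat) (w1 w2 : n.-tuple 'I_3) : Prop :=
  w1 <> w2 /\ cell K w1 `&` cell K w2 !=set0.

Section Averages.
Variables (K : set (R * R)) (nu : probability (R * R)%type R).

Definition cell_avg u (n : nat) (w : n.-tuple 'I_3) : R :=
  (fine (nu (cell K w)))^-1 * \int[nu]_(x in cell K w) u x.

Definition avg_energy u (n : nat) : R :=
  (5 / 3) ^+ n *
  \sum_(w : n.-tuple 'I_3 * n.-tuple 'I_3 | `[< neighbor K w.1 w.2 >])
    (cell_avg u w.1 - cell_avg u w.2) ^+ 2.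

Definition sup_energy u : \bar R :=
  ereal_sup [set (avg_energy u n)%:E | n in [set n | (1 <= n)%N]].

End Averages.
End Gasket.

(* Elements of L^2 are represented by functions, so a subspace [F] of L^2 is a
   set of functions saturated under almost-everywhere equality, and a form must
   not depend on the chosen representatives. The values of [E] outside [F] are
   irrelevant. *)
Section DirichletForm.
Context {d : measure_display} {T : measurableType d} {R : realType}.
Variable nu : {measure set T -> \bar R}.
Implicit Types (F : set (T -> R)) (E : (T -> R) -> (T -> R) -> R).

Definition L2norm (u : T -> R) : R := fine ('N[nu]_(2%:E)[EFin \o u])%E.

Definition form_norm E (u : T -> R) : R := Num.sqrt (E u u + L2norm u ^+ 2).

Record form_domain F : Prop := {
  domain_L2 : forall u, F u -> u \in Lfun nu 2%:E ;
  domain_ae : forall u v, F u -> v \in Lfun nu 2%:E -> u = v %[ae nu] -> F v ;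
  domain_0 : F (cst 0) ;
  domain_lin : forall (a : R) u v, F u -> F v -> F (a *: u + v)
}.

Definition densely_defined F : Prop :=
  forall u, u \in Lfun nu 2%:E -> forall e : R, 0 < e ->
  exists2 v, F v & L2norm (u - v) < e.

Definition closed_form E F : Prop :=
  forall u_ : nat -> T -> R, (forall n, F (u_ n)) ->
  (forall e : R, 0 < e -> exists N : nat, forall m n : nat,
    (N <= m)%N -> (N <= n)%N -> form_norm E (u_ m - u_ n) < e) ->
  exists2 u, F u & (fun n => form_norm E (u_ n - u)) @ \oo --> (0 : R).

Definition markovian E F : Prop :=
  forall u, F u ->
  let v : T -> R := fun x => Num.min (Num.max 0 (u x)) 1 in
  F v /\ E v v <= E u u.

Record dirichlet_form E F : Prop := {
  form_dom : form_domain F ;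
  form_dense : densely_defined F ;
  form_ae : forall u u' v, F u -> F u' -> F v -> u = u' %[ae nu] ->
    E u v = E u' v ;
  form_linear : forall (a : R) u v w, F u -> F v -> F w ->
    E (a *: u + v) w = a * E u w + E v w ;
  form_sym : forall u v, F u -> F v -> E u v = E v u ;
  form_ge0 : forall u, F u -> 0 <= E u u ;
  form_closed : closed_form E F ;
  form_markovian : markovian E F
}.

End DirichletForm.

(* Here [nu] is a measure on the plane carried by [K], so that L^2 of the plane
   is L^2(K; nu), and functions are compared on [K] only. *)
Section FormsOnK.
Variables (R : realType) (K : set (R * R)).
Variable nu : probability (R * R)%type R.
Implicit Types (F : set (R * R -> R))
  (E : (R * R -> R) -> (R * R -> R) -> R).

(* The members of [F] that are continuous on [K] are the continuous
   representatives of the elements of the intersection of [F] and C(K). *)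
Definition regular_form E F : Prop :=
  (forall u, F u -> forall e : R, 0 < e ->
    exists v, [/\ F v, {within K, continuous v} &
      form_norm nu E (u - v) < e]) /\
  (forall g : R * R -> R, {within K, continuous g} ->
    forall e : R, 0 < e -> exists v, [/\ F v, {within K, continuous v} &
      forall x, K x -> `|g x - v x| < e]).

(* The support of the measure [u nu], as [u] is only defined almost
   everywhere. *)
Definition ae_support (u : R * R -> R) : set (R * R) :=
  [set x | K x /\ forall U : set (R * R), open U -> U x ->
    ~ {ae nu, forall y, (U `&` K) y -> u y = 0}].

Definition strongly_local E F : Prop :=
  forall u v, F u -> F v ->
  compact (ae_support u) -> compact (ae_support v) ->
  (exists (U : set (R * R)) (c : R),
    [/\ open U, ae_support u `<=` U &
        {ae nu, forall y, (U `&` K) y -> v y = c}]) ->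
  E u v = 0.

Definition self_similar E F : Prop :=
  forall u, F u ->
  (forall i, F (u \o gasket_map i)) /\
  E u u = 5 / 3 * \sum_(i < 3) E (u \o gasket_map i) (u \o gasket_map i).

End FormsOnK.

(* Main.v *)
(* On a cell of level n, the vertex energies of a continuous function increase
   with the level and bound its oscillation by a multiple of (3/5)^(n/2) times
   the root of its energy; as the mean over a cell then differs from the value
   at a corner by no more than this oscillation, the energies of the cell
   averages are bounded by a multiple of the limit of the vertex energies.
   Conversely, if the energies of the averages are bounded, then the averages
   over neighboring cells of level n differ by O((3/5)^(n/2)), so they determine
   a continuous function; its difference with the given one has mean zero on all
   cells, so it is orthogonal to the continuous functions, which are dense in
   L^2, and vanishes almost everywhere. Telescoping from a cell to its corner, where
   each step contracts by a factor 3/4, bounds the vertex energies of this continuous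
   version. The form is the limit of the vertex energies of the continuous
   versions; it inherits closedness from the sup norm estimate, and piecewise
   harmonic functions make it regular. *)
Require Import Defs.
From mathcomp Require Import measurable_realfun.
From mathcomp Require Import ring lra.

Set Implicit Arguments.
Unset Strict Implicit.
Unset Printing Implicit Defensive.

Local Open Scope classical_set_scope.
Local Open Scope ring_scope.

(** The common frame is recursion on the first letter: a quantity of u at level n + 1 is 5/3 times
    the sum of the quantities at level n of the three functions u o f_i. For the vertex energies
    this is exact, and 5/3 is the factor for which harmonic extension keeps them constant. The
    energies of the averages satisfy it only up to the pairs of neighbors lying in different cells
    of level 1, and these pairs shape the proof. In the upper bound they are compared through their
    common corner. Values at vertices make sense for a class of functions because every cell has
    positive measure: two functions continuous on K that agree almost everywhere agree on all of
    K. *)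

Definition i0 : 'I_3 := @Ordinal 3 0 isT.
Definition i1 : 'I_3 := @Ordinal 3 1 isT.
Definition i2 : 'I_3 := @Ordinal 3 2 isT.

Lemma I3P (P : 'I_3 -> Prop) : P i0 -> P i1 -> P i2 -> forall i, P i.
Proof.
move=> P0 P1 P2 [[|[|[|m]]] hm] //.
- by rewrite (_ : Ordinal hm = i0) //; apply: val_inj.
- by rewrite (_ : Ordinal hm = i1) //; apply: val_inj.
- by rewrite (_ : Ordinal hm = i2) //; apply: val_inj.
Qed.

Lemma sum3E (V : nmodType) (F : 'I_3 -> V) :
  \sum_(i < 3) F i = F i0 + F i1 + F i2.
Proof.
rewrite !big_ord_recl big_ord0 addr0 addrA.
by congr (F _ + F _ + F _); apply: val_inj.
Qed.

(** * Barycentric coordinates, the gasket and its cells *)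

Section Geometry.
Variable R : realType.
Notation pt := (R * R)%type.
Notation p := (@gasket_pt R).

Definition wmap (w : seq 'I_3) : pt -> pt :=
  foldr (fun i g => gasket_map i \o g) id w.

(** Barycentric coordinates of the triangle with corners p_0, p_1, p_2. In them f_i halves every
    coordinate and adds 1/2 to the i-th one, so that questions about cells become linear arithmetic
    without the square root of 3. *)
Definition bary (i : 'I_3) (x : pt) : R :=
  tnth [tuple 1 - x.1 - x.2 / Num.sqrt 3; x.1 - x.2 / Num.sqrt 3;
              2 * (x.2 / Num.sqrt 3)] i.

Lemma sqrt3_neq0 : Num.sqrt 3 != 0 :> R.
Proof. by rewrite sqrtr_eq0 -ltNge. Qed.

Lemma bary_map j i x :
  bary j (gasket_map i x) = (bary j x + (i == j)%:R) / 2.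
Proof.
have := sqrt3_neq0.
elim/I3P: j; elim/I3P: i; rewrite /bary /tnth /= /gasket_map /gasket_pt /tnth /= /GRing.scale /= => h.
all: by field.
Qed.

Lemma bary_sum x : bary i0 x + bary i1 x + bary i2 x = 1.
Proof. by rewrite /bary /tnth /=; ring. Qed.

Lemma bary_pt j i : bary j (p i) = (i == j)%:R.
Proof.
have := sqrt3_neq0.
by elim/I3P: j; elim/I3P: i; rewrite /bary /tnth /= /gasket_pt /tnth /= => h;
  field.
Qed.

Lemma bary_inj x y : (forall i, bary i x = bary i y) -> x = y.
Proof.
case: x y => [a b] [c d] h; have := h i1; have := h i2.
rewrite /bary /tnth /= => /(mulfI _) h2 h1.
have/h2 e2 : 2 != 0 :> R by rewrite pnatr_eq0.
move: (e2); move/(mulIf _) => ->; last by rewrite invr_eq0 sqrt3_neq0.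
by congr (_, _); move: h1; rewrite e2 => /addIr.
Qed.

Lemma gasket_map_inj i : injective (@gasket_map R i).
Proof.
move=> x y /(scalerI _) h; apply: (@addIr _ (p i)); apply: h.
by rewrite invr_eq0 pnatr_eq0.
Qed.

Lemma gasket_map_pt i : gasket_map i (p i) = p i.
Proof. by apply: bary_inj => j; rewrite bary_map bary_pt; field. Qed.

Lemma gasket_map_swap i j : gasket_map i (p j) = gasket_map j (p i).
Proof. by apply: bary_inj => k; rewrite !bary_map !bary_pt addrC. Qed.

Lemma wmap_cat w w' x : wmap (w ++ w') x = wmap w (wmap w' x).
Proof. by elim: w => //= i w ->. Qed.

Lemma wmap_nseq n j : wmap (nseq n j) (p j) = p j.
Proof. by elim: n => //= n ->; rewrite gasket_map_pt. Qed.

Lemma wmapB w (x y : pt) : wmap w x - wmap w y = 2^-1 ^+ size w *: (x - y).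
Proof.
elim: w => [|i w IH] /=; first by rewrite expr0 scale1r.
rewrite /gasket_map -scalerBr opprD addrACA subrr addr0 IH scalerA.
by rewrite exprS.
Qed.

Lemma norm_wmapB w (x y : pt) : `|wmap w x - wmap w y| = 2^-1 ^+ size w * `|x - y|.
Proof. by rewrite wmapB normrZ ger0_norm // exprn_ge0. Qed.

Lemma gasket_map_continuous i : continuous (@gasket_map R i).
Proof.
by move=> x; apply: cvgZr; apply: cvgD; [exact: cvg_id|exact: cvg_cst].
Qed.

Lemma wmap_continuous w : continuous (wmap w).
Proof.
elim: w => [|i w IH] x; first exact: cvg_id.
apply: (@continuous_comp _ _ _ (wmap w) (@gasket_map R i)); first exact: IH.
exact: gasket_map_continuous.
Qed.

Lemma bary_continuous i : continuous (bary i).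
Proof.
have c1 (x : pt) : (fst : pt -> R) y @[y --> x] --> x.1 by exact: cvg_fst.
have c2 (x : pt) : (snd : pt -> R) y @[y --> x] --> x.2 by exact: cvg_snd.
have c3 (x : pt) : (fun y : pt => y.2 / Num.sqrt 3) y @[y --> x] --> x.2 / Num.sqrt 3.
  by apply: (@cvgM _ _ _ _ snd (cst (Num.sqrt 3)^-1)); [exact: c2|exact: cvg_cst].
elim/I3P: i => x; rewrite /bary /tnth /=.
- apply: (@cvgB _ R^o _ _ _ (fun y : pt => 1 - y.1) (fun y : pt => y.2 / Num.sqrt 3)); last exact: c3.
  by apply: (@cvgB _ R^o _ _ _ (cst 1) (fst : pt -> R)); [exact: cvg_cst|exact: c1].
- by apply: (@cvgB _ R^o _ _ _ (fst : pt -> R) (fun y : pt => y.2 / Num.sqrt 3)); [exact: c1|exact: c3].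
- by apply: (@cvgM _ _ _ _ (cst 2) (fun y : pt => y.2 / Num.sqrt 3)); [exact: cvg_cst|exact: c3].
Qed.

Section K.
Variable K : set pt.
Hypothesis hK : is_gasket K.

Lemma Kcompact : compact K. Proof. by case: hK. Qed.

Lemma Kclosed : closed K.
Proof. by apply: compact_closed Kcompact; exact: norm_hausdorff. Qed.

Lemma K_map i x : K x -> K (gasket_map i x).
Proof. by case: hK => _ _ {2}-> Kx; exists i => //; exists x. Qed.

Lemma K_wmap w x : K x -> K (wmap w x).
Proof. by move=> Kx; elim: w => //= i w IH; exact: K_map. Qed.

Lemma K_ind x : K x -> exists i y, K y /\ x = gasket_map i y.
Proof. by case: hK => _ _ {1}-> [i _ [y Ky <-]]; exists i, y. Qed.

Lemma cvg_half : (fun n : nat => (2^-1 : R) ^+ n) @ \oo --> (0 : R).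
Proof. by apply: cvg_expr; rewrite ger0_norm //; lra. Qed.

(** p_i is the limit of the iterates of f_i at any point of K, and K is closed. *)
Lemma K_pt i : K (p i).
Proof.
have [[x Kx] _ _] := hK.
apply: (@closed_cvg _ _ \oo _ (fun n => wmap (nseq n i) x) K Kclosed).
  by apply: nearW => n; exact: K_wmap.
have -> : (fun n => wmap (nseq n i) x) =
    (fun n => p i + 2^-1 ^+ n *: (x - p i)).
  apply/funext => n; have := wmapB (nseq n i) x (p i).
  by rewrite wmap_nseq size_nseq => /(canRL (subrK _)) ->; rewrite addrC.
suff: (fun n => p i + 2^-1 ^+ n *: (x - p i)) @ \oo -->
    p i + (0 : R) *: (x - p i) by rewrite scale0r addr0.
apply: cvgD; first exact: cvg_cst.
by apply: cvgZr_tmp; exact: cvg_half.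
Qed.

(** The minimum m over K is attained at some f_i(y), where the coordinate is at least half of that
    of y; so m >= m / 2. *)
Lemma bary_ge0 j x : K x -> 0 <= bary j x.
Proof.
move=> Kx.
have K0 : K !=set0 by case: hK.
have bc : {within K, continuous (bary j)}.
  by apply: continuous_subspaceT; exact: bary_continuous.
have [c Kc hc] := compact_EVT_min K0 Kcompact bc.
move: Kc; rewrite inE => Kc.
have [i [y [Ky e]]] := K_ind Kc.
have := hc y; rewrite inE => /(_ Ky).
have := hc x; rewrite inE => /(_ Kx); move: (e) => ->; rewrite bary_map.
by case: eqP => _ /=; lra.
Qed.

Lemma bary_le1 j x : K x -> bary j x <= 1.
Proof.
move=> Kx; have := bary_sum x; have := bary_ge0 i0 Kx.
have := bary_ge0 i1 Kx; have := bary_ge0 i2 Kx.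
by elim/I3P: j; lra.
Qed.

Lemma bary_eq1 j x : K x -> bary j x = 1 -> x = p j.
Proof.
move=> Kx h; apply: bary_inj => k; rewrite bary_pt.
have := bary_sum x; have := bary_ge0 i0 Kx.
have := bary_ge0 i1 Kx; have := bary_ge0 i2 Kx.
by move: h; elim/I3P: j; elim/I3P: k => /=; lra.
Qed.

Lemma K_dist x y : K x -> K y -> `|x - y| <= 1.
Proof.
move=> Kx Ky.
have hb z : K z -> [/\ 0 <= z.1, z.1 <= 1, 0 <= z.2 & z.2 <= 1].
  move=> Kz; have := bary_ge0 i0 Kz; have := bary_ge0 i1 Kz.
  have := bary_ge0 i2 Kz; rewrite /bary /tnth /=.
  have s0 : 0 < Num.sqrt (3:R) by rewrite sqrtr_gt0.
  have s2 : Num.sqrt (3:R) <= 2.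
    by rewrite -(@ler_pXn2r _ 2) ?nnegrE ?sqrtr_ge0 // sqr_sqrtr //; lra.
  set t := z.2 / _ => h2 h1 h0.
  have e : z.2 = t * Num.sqrt 3 by rewrite /t divfK // sqrt3_neq0.
  by split; rewrite ?e; nra.
(* The norm is the sup norm, so it suffices that K lies in the unit square. *)
have [? ? ? ?] := hb x Kx; have [? ? ? ?] := hb y Ky.
rewrite prod_normE /= ge_max; apply/andP.
by split; rewrite ler_norml; apply/andP; split; lra.
Qed.

Lemma cell_dist w x y : K x -> K y -> `|wmap w x - wmap w y| <= 2^-1 ^+ size w.
Proof.
move=> Kx Ky; rewrite norm_wmapB -[leRHS]mulr1 ler_wpM2l ?exprn_ge0 //.
exact: K_dist.
Qed.

(** The j-th coordinate is at most 1/2 on f_i(K) and at least 1/2 on f_j(K), so at a common point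
    both bounds are equalities; the same holds with i and j exchanged. *)
Lemma K_meet i j y z : K y -> K z -> i != j ->
  gasket_map i y = gasket_map j z -> y = p j /\ z = p i.
Proof.
move=> Ky Kz ij e.
have := congr1 (bary i) e; have := congr1 (bary j) e; rewrite !bary_map !eqxx.
rewrite (negbTE ij) eq_sym (negbTE ij) /= => e1 e2.
have := bary_ge0 j Kz; have := bary_ge0 i Ky.
have := bary_le1 j Ky; have := bary_le1 i Kz => ? ? ? ?.
by split; apply: bary_eq1 => //; lra.
Qed.

Lemma wmap_corner w j x : K x -> wmap w x = p j ->
  w = nseq (size w) j /\ x = p j.
Proof.
elim: w => //= i w IH Kx /(congr1 (bary j)); rewrite bary_map bary_pt eqxx.
have := bary_le1 j (K_wmap w Kx); case: (eqVneq i j) => [->|ij] /= h e; last first.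
  by exfalso; clear -h e; lra.
have /IH [//|<- ->//] : wmap w x = p j.
by apply: bary_eq1; [exact: K_wmap|lra].
Qed.

(* Cells with different first letters i and j meet only at f_i(p_j) = f_j(p_i). *)
Fixpoint nbr (w w' : seq 'I_3) : bool :=
  match w, w' with
  | i :: v, j :: v' =>
    if i == j then nbr v v' else (v == nseq (size v) j) && (v' == nseq (size v') i)
  | _, _ => false
  end.

Lemma nbr_meet w w' : nbr w w' ->
  exists i j, wmap w (p i) = wmap w' (p j).
Proof.
elim: w w' => [|i w IH] [|j w'] //=; case: eqP => [->|ij].
  by move=> /IH [k [l e]]; exists k, l; rewrite e.
case/andP => /eqP ew /eqP ew'; exists j, i; rewrite ew ew' !wmap_nseq.
exact: gasket_map_swap.
Qed.

Lemma meet_nbr w w' x y : size w = size w' -> K x -> K y -> wmap w x = wmap w' y ->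
  w = w' \/ nbr w w'.
Proof.
elim: w w' => [|i w IH] [|j w'] //=; first by left.
move=> [sz] Kx Ky; case: eqP => [->|/eqP ij].
  by move=> /gasket_map_inj /(IH _ sz Kx Ky) [->|]; [left|right].
move=> /(K_meet (K_wmap _ Kx) (K_wmap _ Ky) ij)
  [/(wmap_corner Kx) [e _] /(wmap_corner Ky) [e' _]].
by right; rewrite {1}e {1}e' !eqxx.
Qed.

Lemma nbr_irr w : nbr w w = false.
Proof. by elim: w => //= i w; rewrite eqxx. Qed.

Lemma neighborP n (w1 w2 : n.-tuple 'I_3) :
  `[< neighbor K w1 w2 >] = nbr w1 w2.
Proof.
apply/asboolP/idP => [[ne [_ [[x Kx <-] [y Ky e]]]]|h].
  have [//|e'|//] := @meet_nbr w1 w2 x y _ Kx Ky (esym e).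
    by rewrite !size_tuple.
  by case: ne; apply: val_inj.
split; first by move=> e; move: h; rewrite e nbr_irr.
have [i [j e]] := nbr_meet h.
by exists (wmap w1 (p i)); split; [exists (p i)|rewrite e; exists (p j)]; rewrite //; exact: K_pt.
Qed.

(** * Sums over neighboring words *)

Lemma sum_tupleS (n : nat) (V : nmodType) (F : seq 'I_3 -> V) :
  \sum_(w : n.+1.-tuple 'I_3) F w =
  \sum_(i < 3) \sum_(w : n.-tuple 'I_3) F (i :: w).
Proof.
rewrite pair_big /=.
rewrite (reindex (fun q : 'I_3 * n.-tuple 'I_3 => [tuple of q.1 :: q.2])) //=.
exists (fun w : n.+1.-tuple 'I_3 => (thead w, [tuple of behead w])).
  by move=> [i w] _; congr (_, _); apply: val_inj.
by move=> w _; rewrite [in RHS](tuple_eta w).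
Qed.

Definition word_energy (c : seq 'I_3 -> R) (n : nat) : R :=
  \sum_(w : n.-tuple 'I_3 * n.-tuple 'I_3 | nbr w.1 w.2) (c w.1 - c w.2) ^+ 2.

Lemma word_energy0 c : word_energy c 0 = 0.
Proof. by rewrite /word_energy big_pred0 // => -[w1 w2] /=; rewrite (tuple0 w1) (tuple0 w2). Qed.

(** Neighbors of level n + 1 either share their first letter, or are the single pair i j^n, j i^n
    belonging to their first letters i and j. *)
Lemma word_energyS c n : word_energy c n.+1 = \sum_(i < 3) word_energy (c \o cons i) n +
  \sum_(i < 3) \sum_(j < 3 | i != j)
     (c (i :: nseq n j) - c (j :: nseq n i)) ^+ 2.
Proof.
have E m d : word_energy d m = \sum_(w : m.-tuple 'I_3) \sum_(w' : m.-tuple 'I_3)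
     if nbr w w' then (d w - d w') ^+ 2 else 0.
  by rewrite /word_energy big_mkcond pair_big /=.
rewrite E (sum_tupleS n (fun w => \sum_(w' : n.+1.-tuple 'I_3)
    if nbr w w' then (c w - c w') ^+ 2 else 0)).
rewrite -big_split /=; apply: eq_bigr => i _.
have eqs (w : n.-tuple 'I_3) j : (tval w == nseq n j) = (w == [tuple of nseq n j]).
  by rewrite -val_eqE.
under eq_bigr => w _ do rewrite (sum_tupleS n (fun w' =>
    if nbr (i :: w) w' then (c (i :: w) - c w') ^+ 2 else 0)) (bigD1 i) //= eqxx.
rewrite big_split /= (E n (c \o cons i)); congr (_ + _).
rewrite exchange_big /=; apply: eq_big => [j|j]; first by rewrite eq_sym.
rewrite eq_sym => /negbTE ji; rewrite ji.
rewrite (bigD1 [tuple of nseq n j]) //= [X in _ + X]big1 ?addr0.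
  rewrite (bigD1 [tuple of nseq n i]) //= [X in _ + X]big1 ?addr0.
    by rewrite !size_nseq !eqxx.
  by move=> w' hw'; rewrite size_tuple eqs (negbTE hw') andbF.
move=> w hw; rewrite big1 // => w' _.
by rewrite !size_tuple eqs (negbTE hw).
Qed.

Notation fm := (@gasket_map R).

Lemma wmap_rcons w i x : wmap (rcons w i) x = wmap w (fm i x).
Proof. by rewrite -cats1 wmap_cat. Qed.

(** * Vertex energies *)

(** This is (5/3)^n times the sum of G (u o f_w) over the words w of length n. Peeling off the
    outermost map lets every induction run on u o f_i. *)
Fixpoint iterS (n : nat) (G : (pt -> R) -> R) (u : pt -> R) : R :=
  if n is m.+1 then 5 / 3 * \sum_(i < 3) iterS m G (u \o fm i) else G u.

Definition e0 (a b : 'I_3 -> R) : R :=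
  \sum_(i < 3) \sum_(j < 3) (a i - a j) * (b i - b j).

Fixpoint en (n : nat) (u v : pt -> R) : R :=
  if n is m.+1 then 5 / 3 * \sum_(i < 3) en m (u \o fm i) (v \o fm i)
  else e0 (u \o p) (v \o p).

Lemma e0_ge0 a : 0 <= e0 a a.
Proof. by apply: sumr_ge0 => i _; apply: sumr_ge0 => j _; rewrite -expr2 sqr_ge0. Qed.

Lemma en_ge0 n u : 0 <= en n u u.
Proof.
elim: n u => [|n IH] u /=; first exact: e0_ge0.
by rewrite mulr_ge0 ?sumr_ge0 //; lra.
Qed.

Lemma en_sym n u v : en n u v = en n v u.
Proof.
elim: n u v => [|n IH] u v /=; last by under eq_bigr do rewrite IH.
by rewrite /e0; apply: eq_bigr => i _; apply: eq_bigr => j _; rewrite mulrC.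
Qed.

Lemma en_linear n a u v w : en n (a *: u + v) w = a * en n u w + en n v w.
Proof.
elim: n u v w => [|n IH] u v w /=.
  rewrite /e0 mulr_sumr -big_split /=; apply: eq_bigr => i _.
  rewrite mulr_sumr -big_split /=; apply: eq_bigr => j _.
  have E x : (a *: u + v) x = a * u x + v x by [].
  by rewrite !E; ring.
under eq_bigr => i _ do rewrite (_ : (a *: u + v) \o fm i =
  a *: (u \o fm i) + (v \o fm i)) // IH.
by rewrite big_split /= -mulr_sumr; ring.
Qed.

Lemma eq_en n u u' v v' : {in K, u =1 u'} -> {in K, v =1 v'} ->
  en n u v = en n u' v'.
Proof.
elim: n u u' v v' => [|n IH] u u' v v' hu hv /=.
  rewrite /e0; apply: eq_bigr => i _; apply: eq_bigr => j _ /=.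
  by rewrite !hu ?hv // inE; exact: K_pt.
congr (_ * _); apply: eq_bigr => i _; apply: IH => x; rewrite !inE => Kx /=.
  by apply: hu; rewrite inE; exact: K_map.
by apply: hv; rewrite inE; exact: K_map.
Qed.

Lemma en_contract (phi : R -> R) n u : (forall s t, `|phi s - phi t| <= `|s - t|) ->
  en n (phi \o u) (phi \o u) <= en n u u.
Proof.
move=> h; elim: n u => [|n IH] u /=.
  apply: ler_sum => i _; apply: ler_sum => j _.
  rewrite -!expr2 -[leLHS]real_normK ?num_real // -[leRHS]real_normK ?num_real //.
  by rewrite lerXn2r ?nnegrE //; exact: h.
apply: ler_wpM2l; first lra.
by apply: ler_sum => i _; exact: IH.
Qed.

(* X, Y, Z below are the deviations of x, y, z from the harmonic midpoint values. *)
Lemma e0_harmonic_le (a b c x y z : R) (u := tnth [tuple a; b; c])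
   (u0 := tnth [tuple a; z; y]) (u1 := tnth [tuple z; b; x])
   (u2 := tnth [tuple y; x; c]) :
  e0 u u <= 5 / 3 * (e0 u0 u0 + e0 u1 u1 + e0 u2 u2).
Proof.
rewrite /e0 !sum3E /u /u0 /u1 /u2 /tnth /= -subr_ge0.
set e := (X in 0 <= X).
pose X := x - (2 * b + 2 * c + a) / 5.
pose Y := y - (2 * a + 2 * c + b) / 5.
pose Z := z - (2 * a + 2 * b + c) / 5.
have -> : e = 10 / 3 * (2 * X ^+ 2 + 2 * Y ^+ 2 + 2 * Z ^+ 2 +
    (Z - Y) ^+ 2 + (Z - X) ^+ 2 + (Y - X) ^+ 2).
  by rewrite /e /X /Y /Z; field.
apply: mulr_ge0; first lra.
have := sqr_ge0 X; have := sqr_ge0 Y; have := sqr_ge0 Z.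
have := sqr_ge0 (Z - Y); have := sqr_ge0 (Z - X); have := sqr_ge0 (Y - X).
by move: X Y Z => X Y Z; lra.
Qed.

(** Among all choices of values at the new vertices the harmonic one has least energy, and it
    reproduces the energy of the previous level. *)
Lemma en_le_S n u : en n u u <= en n.+1 u u.
Proof.
elim: n u => [|n IH] u; last first.
  rewrite [leLHS]/= [leRHS]/=; apply: ler_wpM2l; first lra.
  by apply: ler_sum => i _; exact: IH.
have := e0_harmonic_le (u (p i0)) (u (p i1)) (u (p i2))
  (u (fm i1 (p i2))) (u (fm i0 (p i2))) (u (fm i0 (p i1))).
rewrite /= sum3E /e0 !sum3E /tnth /= !gasket_map_pt.
by rewrite (gasket_map_swap i1 i0) (gasket_map_swap i2 i0) (gasket_map_swap i2 i1).
Qed.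

Lemma en_homo u : {homo (fun n => en n u u) : m n / (m <= n)%N >-> m <= n}.
Proof. by apply: homo_leq => //; [exact: le_trans|move=> n; exact: en_le_S]. Qed.

Definition bounded_en u := exists M, forall n, en n u u <= M.
Definition limit_energy u : R := limn (fun n => en n u u).

Lemma cvg_en u : bounded_en u -> (fun n => en n u u) @ \oo --> limit_energy u.
Proof.
move=> [M hM]; apply: nondecreasing_is_cvgn; first exact: en_homo.
by exists M => _ [n _ <-].
Qed.

Lemma en_le_limit n u : bounded_en u -> en n u u <= limit_energy u.
Proof.
by move=> h; apply: nondecreasing_cvgn_le; [exact: en_homo|exact: cvg_en].
Qed.

Lemma limit_energy_le M u : (forall n, en n u u <= M) -> limit_energy u <= M.
Proof.
move=> h; apply: limr_le; first by apply: cvg_en; exists M.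
exact: nearW.
Qed.

(** The other two children contribute nonnegative energy. Iterating this bound gives the decay
    (3/5)^(n/2) of oscillations. *)
Lemma en_sub i n u M : en n.+1 u u <= M -> en n (u \o fm i) (u \o fm i) <= 3 / 5 * M.
Proof.
move=> /= h; have := en_ge0 n (u \o fm i0); have := en_ge0 n (u \o fm i1).
by have := en_ge0 n (u \o fm i2); move: h; rewrite sum3E; elim/I3P: i; lra.
Qed.

Lemma bounded_en_sub i u : bounded_en u -> bounded_en (u \o fm i).
Proof. by move=> [M h]; exists (3 / 5 * M) => n; apply: en_sub. Qed.

Lemma bounded_enS u : (forall i, bounded_en (u \o fm i)) -> bounded_en u.
Proof.
move=> h; have [M0 h0] := h i0; have [M1 h1] := h i1; have [M2 h2] := h i2.
exists (5 / 3 * (M0 + M1 + M2)) => n; apply: le_trans (en_le_S _ _) _.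
by rewrite /= sum3E; have := h0 n; have := h1 n; have := h2 n; lra.
Qed.

Lemma limit_energyS u : bounded_en u -> limit_energy u = 5 / 3 * \sum_(i < 3) limit_energy (u \o fm i).
Proof.
move=> h; have h1 : (fun n => en n.+1 u u) @ \oo --> limit_energy u.
  by rewrite (cvg_shiftS (fun n => en n u u)); exact: cvg_en.
apply: (cvg_unique _ h1) => //=.
apply: cvgM; first exact: cvg_cst.
rewrite sum3E; under eq_fun do rewrite sum3E.
by apply: cvgD; [apply: cvgD|]; apply: cvg_en; exact: bounded_en_sub.
Qed.

Lemma limit_energy_ge0 u : bounded_en u -> 0 <= limit_energy u.
Proof. by move=> h; apply: le_trans (en_le_limit 0 h); exact: en_ge0. Qed.

Lemma e0_diff_le a i j (m : R) : 0 <= m -> e0 a a <= m ^+ 2 -> `|a i - a j| <= m.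
Proof.
move=> m0; rewrite /e0 !sum3E => h.
rewrite -(@ler_pXn2r _ 2) ?nnegrE // real_normK ?num_real //.
move: h (sqr_ge0 (a i0 - a i1)) (sqr_ge0 (a i0 - a i2)) (sqr_ge0 (a i1 - a i2)) (sqr_ge0 m).
by elim/I3P: i; elim/I3P: j; lra.
Qed.

(** Since 3/5 <= (4/5)^2, a child satisfies the hypothesis with 4/5 m. Going from the vertex to the
    corner j of the child i, then to its corner i, which is p_i, then to p_j costs at most 8 m + 4/5
    m + m, and this is below 10 m. *)
Lemma osc_vertex v (m : R) : 0 <= m -> (forall n, en n v v <= m ^+ 2) ->
  forall w j, `|v (wmap w (p j)) - v (p j)| <= 10 * m.
Proof.
move=> m0 hm w; elim: w v m m0 hm => [|i w IH] v m m0 hm j.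
  by rewrite /= subrr normr0; lra.
have m1 : 0 <= 4 / 5 * m by lra.
have hi n : en n (v \o fm i) (v \o fm i) <= (4 / 5 * m) ^+ 2.
  by apply: le_trans (en_sub i (hm n.+1)) _; nra.
have := IH _ _ m1 hi j.
have := e0_diff_le i j m0 (hm 0).
have := e0_diff_le i j m1 (hi 0).
rewrite /= gasket_map_pt !ler_norml => /andP[? ?] /andP[? ?] /andP[? ?].
by apply/andP; split; lra.
Qed.

Lemma K_word n x : K x -> exists w y, [/\ size w = n, K y & x = wmap w y].
Proof.
elim: n x => [|n IH] x Kx; first by exists [::], x.
have [i [y [Ky ->]]] := K_ind Kx.
by have [w [z [sw Kz ->]]] := IH _ Ky; exists (i :: w), z; rewrite /= sw.
Qed.

(* Continuity on [K] in terms of the oscillation on cells. *)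
Definition uc (v : pt -> R) := forall e : R, 0 < e -> exists N : nat,
  forall w x y, (N <= size w)%N -> K x -> K y ->
    `|v (wmap w x) - v (wmap w y)| < e.

Lemma uc_sub i v : uc v -> uc (v \o fm i).
Proof.
move=> h e e0; have [N hN] := h e e0; exists N => w x y sw Kx Ky.
by apply: (hN (i :: w)) => //=; rewrite ltnW.
Qed.

Lemma osc_en v (m : R) : uc v -> 0 <= m -> (forall n, en n v v <= m ^+ 2) ->
  forall x j, K x -> `|v x - v (p j)| <= 10 * m.
Proof.
move=> uv m0 hm x j Kx; apply/ler_addgt0Pr => e e_gt0.
have [N hN] := uv e e_gt0.
have [w [y [sw Ky ->]]] := K_word N Kx.
have := osc_vertex m0 hm w j.
have := hN w y (p j); rewrite sw => /(_ (leqnn _) Ky (K_pt j)).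
by rewrite ltr_norml !ler_norml => /andP[? ?] /andP[? ?]; apply/andP; split; lra.
Qed.

Lemma osc_en2 v (m : R) : uc v -> 0 <= m -> (forall n, en n v v <= m ^+ 2) ->
  forall x y, K x -> K y -> `|v x - v y| <= 20 * m.
Proof.
move=> uv m0 hm x y Kx Ky.
have := osc_en uv m0 hm i0 Kx; have := osc_en uv m0 hm i0 Ky.
by rewrite !ler_norml => /andP[? ?] /andP[? ?]; apply/andP; split; lra.
Qed.

(* A decay rate above both 3/5, the rate of harmonic functions, and (3/5)^(1/2),
   the rate given by an energy bound. *)
Notation r := (4 / 5 : R).

Lemma cvg_r : (fun n : nat => r ^+ n) @ \oo --> (0 : R).
Proof. by apply: cvg_expr; rewrite ger0_norm; lra. Qed.

Lemma r_small M e : 0 < e -> exists N, forall n, (N <= n)%N -> M * r ^+ n < e.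
Proof.
move=> e_gt0.
have : (fun n => M * r ^+ n) @ \oo --> M * 0.
  by apply: cvgM; [exact: cvg_cst|exact: cvg_r].
rewrite mulr0 => /cvgr0_norm_lt /(_ e e_gt0) [N _ hN].
by exists N => n hn; apply: le_lt_trans (ler_norm _) (hN n hn).
Qed.

Lemma r_eq0 (t M : R) : (forall n, `|t| <= M * r ^+ n) -> t = 0.
Proof.
move=> h; apply/eqP; rewrite -normr_le0; apply/ler_addgt0Pr => e e_gt0.
have [N hN] := r_small M e_gt0; rewrite add0r.
by apply: le_trans (h N) (ltW (hN N _)).
Qed.

(** * Continuous functions from values on words, and harmonic splines *)

Lemma uc_of_words (h : pt -> R) c M :
  (forall w x, K x -> `|h (wmap w x) - c w| <= M * r ^+ size w) -> uc h.
Proof.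
move=> H e e_gt0; have [N hN] := r_small (2 * M) e_gt0.
exists N => w x y /hN he Kx Ky; have := H w x Kx; have := H w y Ky.
rewrite ltr_norml !ler_norml => /andP[? ?] /andP[? ?]; apply/andP.
by rewrite -mulrA in he; split; lra.
Qed.

(** Common source of the splines and of the continuous versions. The first condition makes the
    values converge along an address, the second reconciles different addresses of one point. *)
Lemma extend_words (c : seq 'I_3 -> R) (M : R) : 0 <= M ->
  (forall w i, `|c (rcons w i) - c w| <= M * r ^+ size w) ->
  (forall w w', size w = size w' -> nbr w w' -> `|c w - c w'| <= M * r ^+ size w) ->
  exists h, forall w x, K x -> `|h (wmap w x) - c w| <= 6 * M * r ^+ size w.
Proof.
move=> M0 H1 H2.
(* A point of K can have several addresses. [st] fixes a first letter and a preimage for every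
   point, with a dummy value off K. *)
have /choice[st hst] : forall x, exists iy : 'I_3 * pt,
    K x -> K iy.2 /\ x = fm iy.1 iy.2.
  move=> x; case: (pselect (K x)) => [/(K_ind)[i [y h]]|nK]; last by exists (i0, x).
  by exists (i, y).
pose z n x := iter n (fun y => (st y).2) x.
pose fix pre n x {struct n} : seq 'I_3 := if n is m.+1 then rcons (pre m x) (st (z m x)).1 else [::].
have spre n x : size (pre n x) = n by elim: n => //= n IH; rewrite size_rcons IH.
have zK n x : K x -> K (z n x) /\ x = wmap (pre n x) (z n x).
  move=> Kx; elim: n => [//|n [Kz e]]; have [Kz' e'] := hst _ Kz.
  by split => //=; rewrite wmap_rcons -e' -e.
(* The radius is the sum of the tail of M r^k over k >= n. The intervals from [a] to [b] are nested
   because 1 + 5 * (4/5) = 5. *)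
pose a x n := c (pre n x) - 5 * M * r ^+ n.
pose b x n := c (pre n x) + 5 * M * r ^+ n.
have rn n : 0 <= M * r ^+ n by rewrite mulr_ge0 // exprn_ge0 //; lra.
have am x : {homo a x : m n / (m <= n)%N >-> m <= n}.
  apply: homo_leq => //; first exact: le_trans.
  move=> n; have := H1 (pre n x) (st (z n x)).1; rewrite spre /a /= exprS.
  by have := rn n; rewrite ler_norml => ? /andP[? ?]; lra.
have bm x : {homo b x : m n / (m <= n)%N >-> n <= m}.
  apply: homo_leq => //; first by move=> y1 y2 y3 h1 h2; exact: le_trans h2 h1.
  move=> n; have := H1 (pre n x) (st (z n x)).1; rewrite spre /b /= exprS.
  by have := rn n; rewrite ler_norml => ? /andP[? ?]; lra.
have ab x m n : a x m <= b x n.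
  apply: (@le_trans _ _ (a x (maxn m n))); first by apply: am; exact: leq_maxl.
  apply: (@le_trans _ _ (b x (maxn m n))); last by apply: bm; exact: leq_maxr.
  by rewrite /a /b; have := rn (maxn m n); lra.
pose h x := sup (range (a x)).
have hs x : has_sup (range (a x)).
  by split; [exists (a x 0%N), 0%N|exists (b x 0%N) => _ [n _ <-]].
have hh x n : `|h x - c (pre n x)| <= 5 * M * r ^+ n.
  have h1 : a x n <= h x by apply: sup_upper_bound => //; exists n.
  have h2 : h x <= b x n.
    by apply: sup_le_ub; [case: (hs x)|move=> _ [m _ <-]].
  by move: h1 h2; rewrite /a /b ler_norml => ? ?; apply/andP; split; lra.
exists h => w x Kx.
have Kx' : K (wmap w x) by exact: K_wmap.
set n := size w.
have [Kz e] := zK n _ Kx'.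
(* The chosen address of f_w(x) need not begin with w, but its prefix of the same length is w or a
   neighbor of w. This turns the constant 5 into 6. *)
have h1 : `|c (pre n (wmap w x)) - c w| <= M * r ^+ n.
  have [|<-|h2] := @meet_nbr w (pre n (wmap w x)) x (z n (wmap w x)) _ Kx Kz e.
  - by rewrite spre.
  - by rewrite subrr normr0.
  - by rewrite distrC; apply: H2; rewrite ?spre.
have := hh (wmap w x) n; move: h1.
by rewrite !ler_norml => /andP[? ?] /andP[? ?]; apply/andP; split; lra.
Qed.

(* The 2/5-2/5-1/5 rule: corner values on the child [i] of the harmonic function
   with corner values [a]. *)
Definition harmonic_step (i : 'I_3) (a : 'I_3 -> R) (j : 'I_3) : R :=
  if i == j then a i else (a i + a j + \sum_(k < 3) a k) / 5.

Fixpoint harm (a : 'I_3 -> R) (w : seq 'I_3) : 'I_3 -> R :=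
  if w is i :: v then harm (harmonic_step i a) v else a.

(* Values at the corners of the cell [w] of the function that agrees with [g]
   on the vertices of level [N] and is harmonic on each cell of level [N]. *)
Fixpoint spline (N : nat) (g : pt -> R) (w : seq 'I_3) : 'I_3 -> R :=
  match N, w with
  | 0, _ => harm (g \o p) w
  | _.+1, [::] => g \o p
  | N'.+1, i :: v => spline N' (g \o fm i) v
  end.

(** The case of equality in [e0_harmonic_le]. *)
Lemma e0_harmonic_step a : 5 / 3 * \sum_(i < 3) e0 (harmonic_step i a) (harmonic_step i a) = e0 a a.
Proof. by rewrite /e0 !sum3E /harmonic_step /= !sum3E; field. Qed.

Lemma harm_rcons a w i : harm a (rcons w i) = harmonic_step i (harm a w).
Proof. by elim: w a => //= j w IH a; rewrite IH. Qed.

Lemma spline_nil N g : spline N g [::] = g \o p.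
Proof. by case: N. Qed.

(** This and [spline_swap] mirror the identities f_i(p_i) = p_i and f_i(p_j) = f_j(p_i); they are
    the compatibility needed to glue the values of neighboring cells in [nbr_corner]. *)
Lemma spline_corner N g w i : spline N g (rcons w i) i = spline N g w i.
Proof.
elim: N g w => [|N IH] g w /=; first by rewrite harm_rcons /harmonic_step eqxx.
by case: w => [|j w] /=; rewrite ?spline_nil ?IH //= gasket_map_pt.
Qed.

Lemma spline_swap N g w i j : spline N g (rcons w i) j = spline N g (rcons w j) i.
Proof.
elim: N g w => [|N IH] g w /=.
  by rewrite !harm_rcons /harmonic_step eq_sym; case: eqP => [->//|_]; rewrite (addrC (harm _ _ i)).
by case: w => [|k w] /=; rewrite ?spline_nil ?IH //= gasket_map_swap.
Qed.

Lemma harmonic_step_osc M i a : (forall j k, `|a j - a k| <= M) ->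
  forall j k, `|harmonic_step i a j - harmonic_step i a k| <= r * M.
Proof.
move=> h j k; have M0 : 0 <= M by apply: le_trans (h i0 i0).
have := h i0 i1; have := h i0 i2; have := h i1 i2; rewrite /harmonic_step !sum3E.
rewrite !ler_norml => /andP[? ?] /andP[? ?] /andP[? ?].
by elim/I3P: i; elim/I3P: j; elim/I3P: k; rewrite /=; apply/andP; split; lra.
Qed.

Lemma harm_osc M a w : (forall j k, `|a j - a k| <= M) ->
  forall j k, `|harm a w j - harm a w k| <= M * r ^+ size w.
Proof.
elim: w a M => [|i w IH] a M h j k /=; first by rewrite expr0 mulr1.
by have := IH _ _ (harmonic_step_osc i h) j k; rewrite exprS mulrCA mulrA.
Qed.

Lemma spline_osc N g : exists2 M, 0 <= M &
  forall w j k, `|spline N g w j - spline N g w k| <= M * r ^+ size w.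
Proof.
have osc0 (a : 'I_3 -> R) : exists2 M, 0 <= M & forall j k, `|a j - a k| <= M.
  exists (`|a i0 - a i1| + `|a i0 - a i2| + `|a i1 - a i2|); first by rewrite !addr_ge0.
  have := normr_ge0 (a i0 - a i1); have := normr_ge0 (a i0 - a i2).
  have := normr_ge0 (a i1 - a i2) => ? ? ? j k.
  by elim/I3P: j; elim/I3P: k; rewrite ?subrr ?normr0 1?(distrC (a i1) (a i0))
    1?(distrC (a i2) (a i0)) 1?(distrC (a i2) (a i1)); lra.
elim: N g => [|N IH] g.
  by have [M M0 hM] := osc0 (g \o p); exists M => // w; exact: harm_osc.
have [M M0 hM] := osc0 (g \o p).
have [Ma Ma0 ha] := IH (g \o fm i0); have [Mb Mb0 hb] := IH (g \o fm i1).
have [Mc Mc0 hc] := IH (g \o fm i2).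
(* Within a child the word is one letter shorter; 5/4 is the inverse of the rate. *)
exists (M + 5 / 4 * (Ma + Mb + Mc)); first lra.
move=> [|i w] j k /=; first by rewrite expr0; have := hM j k; rewrite /=; lra.
have : `|spline N (g \o fm i) w j - spline N (g \o fm i) w k| <=
    (Ma + Mb + Mc) * r ^+ size w.
  have rn : 0 <= r ^+ size w by rewrite exprn_ge0 //; lra.
  elim/I3P: i; [apply: le_trans (ha w j k) _|apply: le_trans (hb w j k) _|
    apply: le_trans (hc w j k) _]; rewrite ler_wpM2r //; lra.
move/le_trans; apply; rewrite exprS.
have rn : 0 <= M * r ^+ size w by rewrite mulr_ge0 ?exprn_ge0 //; lra.
by nra.
Qed.

(** Maximum principle: [harmonic_step] forms convex combinations. *)
Lemma harm_max e t a w : (forall j, `|a j - t| <= e) -> forall j, `|harm a w j - t| <= e.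
Proof.
elim: w a => //= i w IH a h; apply: IH => j.
have := h i0; have := h i1; have := h i2; rewrite /harmonic_step sum3E.
rewrite !ler_norml => /andP[? ?] /andP[? ?] /andP[? ?].
by elim/I3P: i; elim/I3P: j; rewrite /=; apply/andP; split; lra.
Qed.

Lemma spline_max e t N g w w' : size w = N ->
  (forall j, `|g (wmap w (p j)) - t| <= e) ->
  forall j, `|spline N g (w ++ w') j - t| <= e.
Proof.
elim: N g w => [|N IH] g [|i w] //= sw h j; first exact: harm_max.
by apply: IH => //; case: sw.
Qed.

Lemma nseq_rcons T n (x : T) : nseq n.+1 x = rcons (nseq n x) x.
Proof. by elim: n => //= n <-. Qed.

Lemma corner_nseq (b : seq 'I_3 -> 'I_3 -> R) w n j :
  (forall w i, b (rcons w i) i = b w i) -> b (w ++ nseq n j) j = b w j.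
Proof.
move=> hb; elim: n => [|n IH]; first by rewrite cats0.
by rewrite nseq_rcons -rcons_cat hb.
Qed.

Lemma nbr_corner (b : seq 'I_3 -> 'I_3 -> R) w w' :
  (forall w i, b (rcons w i) i = b w i) ->
  (forall w i j, b (rcons w i) j = b (rcons w j) i) ->
  nbr w w' -> exists i j, b w i = b w' j.
Proof.
elim: w w' b => [|i w IH] [|j w'] //= b h1 h2; case: eqP => [<-|_].
  by move=> /(IH _ (b \o cons i)); apply => [v k|v k l] /=; rewrite -!rcons_cons.
case/andP => /eqP-> /eqP->; exists j, i.
have := @corner_nseq b [:: i] (size w) j h1; have := @corner_nseq b [:: j] (size w') i h1.
by rewrite /= => -> ->; exact: (h2 [::]).
Qed.

Lemma spline_extend N g : exists2 h, uc h & forall w j, h (wmap w (p j)) = spline N g w j.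
Proof.
have [M M0 hM] := spline_osc N g.
have rn n : 0 <= M * r ^+ n by rewrite mulr_ge0 // exprn_ge0 //; lra.
(* Corner 0 represents the cell. A cell shares a corner with each child and with each neighbor, and
   the oscillation on either side of it is bounded by M times the rate. *)
have [|||h hh] := @extend_words (fun w => spline N g w i0) (2 * M).
- lra.
- move=> w i; have := hM (rcons w i) i0 i; have := hM w i i0.
  rewrite spline_corner size_rcons exprS; have := rn (size w).
  by rewrite !ler_norml => ? /andP[? ?] /andP[? ?]; apply/andP; split; lra.
- move=> w w' sw /(nbr_corner (@spline_corner N g) (@spline_swap N g))[i [j e]].
  have := hM w i i0; have := hM w' j i0; rewrite -sw e.
  by rewrite !ler_norml => /andP[? ?] /andP[? ?]; apply/andP; split; lra.
exists h; first exact: uc_of_words hh.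
move=> w j; apply/eqP; rewrite -subr_eq0; apply/eqP.
(* The point f_w(p_j) lies in all cells w j^n. There the extension is accurate up to a multiple 6 *
   2 of M, and moving from corner 0 to corner j adds one more. *)
apply: (@r_eq0 _ (13 * M)) => n.
have := hh (w ++ nseq n j) (p j) (K_pt j); have := hM (w ++ nseq n j) i0 j.
rewrite wmap_cat wmap_nseq size_cat size_nseq exprD (corner_nseq _ _ _ (@spline_corner N g)).
have : M * (r ^+ size w * r ^+ n) <= M * r ^+ n.
  rewrite ler_wpM2l // -[leRHS]mul1r ler_wpM2r ?exprn_ge0 ?exprn_ile1 //; lra.
by rewrite !ler_norml => ? /andP[? ?] /andP[? ?]; apply/andP; split; lra.
Qed.

Lemma spline_bounded_en N g h :
  (forall w j, h (wmap w (p j)) = spline N g w j) -> bounded_en h.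
Proof.
elim: N g h => [|N IH] g h hh; last first.
  by apply: bounded_enS => i; apply: (IH (g \o fm i)) => w j; exact: (hh (i :: w)).
exists (e0 (g \o p) (g \o p)) => n; have {hh} : forall w j, h (wmap w (p j)) = harm (g \o p) w j by [].
elim: n h (g \o p) => [|n In] h a hh /=.
  have -> : h \o p = a by apply/funext => j; exact: (hh [::]).
  by [].
rewrite -[leRHS]e0_harmonic_step; apply: ler_wpM2l; first lra.
by apply: ler_sum => i _; apply: In => w j; exact: (hh (i :: w)).
Qed.

(** One e comes from the maximum principle on a cell of level N, the other from the oscillation of g
    on that cell. *)
Lemma spline_approx N g h (e : R) : uc h -> (forall w j, h (wmap w (p j)) = spline N g w j) ->
  (forall w x y, size w = N -> K x -> K y -> `|g (wmap w x) - g (wmap w y)| <= e) ->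
  forall x, K x -> `|h x - g x| <= 2 * e.
Proof.
move=> uh hh hg x Kx; apply/ler_addgt0Pr => d d_gt0.
have [n hn] := uh d d_gt0.
have [w [y [sw Ky ->]]] := K_word N Kx.
have [w' [z [sw' Kz ->]]] := K_word n Ky.
have := hn (w ++ w') z (p i0); rewrite size_cat sw' leq_addl => /(_ isT Kz (K_pt i0)).
have h1 j : `|g (wmap w (p j)) - g (wmap w (p i0))| <= e by apply: hg => //; exact: K_pt.
have := spline_max w' sw h1 i0; rewrite hh.
have := hg w (p i0) (wmap w' z) sw (K_pt i0) (K_wmap w' Kz).
rewrite wmap_cat !ltr_norml !ler_norml.
by move=> /andP[? ?] /andP[? ?] /andP[? ?]; apply/andP; split; lra.
Qed.

(** * Self-similarity of the measure *)

Section Hausdorff.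
Implicit Types (A B U : set pt).

Lemma ediam_ge0 U : (0 <= ediam U)%E.
Proof. by rewrite /ediam le_max lexx. Qed.

Lemma ediam_le U t : (0 <= t)%E ->
  (forall x y, U x -> U y -> ((edist x y)%:E <= t)%E) -> (ediam U <= t)%E.
Proof.
move=> t0 h; rewrite /ediam ge_max t0 /=; apply: ge_ereal_sup.
by move=> _ [x Ux [y Uy <-]]; exact: h.
Qed.

Lemma le_ediam U x y : U x -> U y -> ((edist x y)%:E <= ediam U)%E.
Proof.
move=> Ux Uy; rewrite /ediam le_max; apply/orP; right.
by apply: ereal_sup_ubound; exists x => //; exists y.
Qed.

Lemma hausdorff_lipschitz (s c : R) (g : pt -> pt) B : 0 <= s -> 0 < c ->
  (forall x y, edist (g x) (g y) <= c * edist x y) ->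
  (hausdorff s (g @` B) <= (c `^ s)%:E * hausdorff s B)%E.
Proof.
move=> s0 c0 hg.
have cs : 0 < c `^ s by exact: powR_gt0.
have dU U : (ediam (g @` U) <= c%:E * ediam U)%E.
  apply: ediam_le; first by rewrite mule_ge0 ?lee_fin ?ediam_ge0 // ltW.
  move=> _ _ [x Ux <-] [y Uy <-]; apply: (@le_trans _ _ (c * edist x y)%:E).
    by rewrite lee_fin.
  by rewrite EFinM lee_pmul2l //; exact: le_ediam.
apply: ge_ereal_sup => _ [d /= d0 <-].
apply: (@le_trans _ _ ((c `^ s)%:E * hausdorff_content s (d / c) B)%E); last first.
  rewrite lee_pmul2l //; apply: ereal_sup_ubound; exists (d / c) => //=.
  by rewrite divr_gt0.
rewrite -lee_pdivrMl //; apply: le_ereal_inf_tmp => _ [U [BU dUd] <-].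
rewrite lee_pdivrMl // -nneseriesZl; last by move=> k _; exact: poweR_ge0.
apply: (@le_trans _ _ (\sum_(0 <= k <oo) ediam (g @` U k) `^ s)%E).
  apply: ereal_inf_lbound; exists (fun k => g @` U k) => //; split.
    by move=> _ [x /BU[k _ Ukx] <-]; exists k => //; exists x.
  move=> k; apply: le_trans (dU _) _.
  by rewrite -lee_pdivlMl // -EFinM mulrC.
apply: lee_nneseries => k; first by move=> *; exact: poweR_ge0.
move=> _; rewrite -poweR_EFin -poweRM ?ediam_ge0 ?lee_fin //; last exact: ltW.
apply: gt0_ler_poweR => //; rewrite in_itv /= ?leey ?andbT ?ediam_ge0 //.
by rewrite mule_ge0 ?lee_fin ?ediam_ge0 // ltW.
Qed.

Lemma edist_map i (x y : pt) : edist (fm i x) (fm i y) = 2^-1 * edist x y.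
Proof.
rewrite /edist /gasket_map /=.
have -> : (2^-1 *: (x.1 + (p i).1) - 2^-1 *: (y.1 + (p i).1)) ^+ 2 +
    (2^-1 *: (x.2 + (p i).2) - 2^-1 *: (y.2 + (p i).2)) ^+ 2 =
    (2^-1) ^+ 2 * ((x.1 - y.1) ^+ 2 + (x.2 - y.2) ^+ 2).
  by rewrite /GRing.scale /=; field.
by rewrite sqrtrM ?sqr_ge0 // sqrtr_sqr ger0_norm.
Qed.

Lemma gasket_dim_ge0 : 0 <= gasket_dim R.
Proof. by rewrite divr_ge0 // ln_ge0 //; lra. Qed.

Lemma powR_dim : 2 `^ gasket_dim R = 3.
Proof.
rewrite /powR pnatr_eq0 /= /gasket_dim divfK ?lnK ?posrE //.
by rewrite gt_eqF // ln_gt0 //; lra.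
Qed.

(** Both inequalities are Lipschitz bounds: f_i has constant 1/2, its inverse has constant 2, and 2
    to the power [gasket_dim] is 3. *)
Lemma hausdorff_map i B : (hausdorff (gasket_dim R) B =
  3%:E * hausdorff (gasket_dim R) (fm i @` B))%E.
Proof.
apply/eqP; rewrite eq_le; apply/andP; split.
  pose g (x : pt) : pt := 2 *: x - p i.
  have gK : cancel (fm i) g.
    move=> x; rewrite /g /gasket_map scalerA mulfV ?pnatr_eq0 // scale1r.
    by rewrite addrK.
  rewrite -powR_dim; rewrite -[X in (hausdorff _ X <= _)%E](_ : g @` (fm i @` B) = B).
    apply: hausdorff_lipschitz; rewrite ?gasket_dim_ge0 //.
    move=> x y; rewrite -(@ler_pM2l _ 2^-1) // mulKf ?pnatr_eq0 //.
    rewrite -(edist_map i) /g /gasket_map !subrK !scalerA mulVf ?pnatr_eq0 //.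
    by rewrite !scale1r.
  by rewrite image_comp -[RHS]image_id; apply: eq_imagel => x _ /=; rewrite gK.
rewrite -lee_pdivlMl //.
have -> : (3 : R)^-1 = 2^-1 `^ gasket_dim R by rewrite -powR_dim -powRN -powR_inv1 // -powRrM mulN1r.
apply: hausdorff_lipschitz; rewrite ?gasket_dim_ge0 //.
by move=> x y; rewrite edist_map.
Qed.

End Hausdorff.

(** * Borel sets of the plane *)

Lemma open_measurable_plane (U : set pt) : open U -> measurable U.
Proof.
move=> oU.
pose box (q : (rat * rat) * (rat * rat)) : set pt :=
  `]ratr q.1.1, ratr q.1.2[%classic `*` `]ratr q.2.1, ratr q.2.2[%classic.
pose F q := if `[< box q `<=` U >] then box q else set0.
have -> : U = \bigcup_q F q.
  apply/seteqP; split => [[x1 x2] Ux|x [q _]]; last first.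
    by rewrite /F; case: asboolP => // h; exact: h.
  have /nbhs_ballP[e /= e_gt0 he] : nbhs (x1, x2) U by exact: open_nbhs_nbhs.
  have rr (z : R) : exists a b : rat, [/\ ratr a < z, z < ratr b, z - e < ratr a
      & ratr b < z + e].
    have /rat_in_itvoo[a] : z - e < z by lra.
    have /rat_in_itvoo[b] : z < z + e by lra.
    by rewrite !in_itv /= => /andP[? ?] /andP[? ?]; exists a, b.
  have [a [b [h1 h2 h3 h4]]] := rr x1; have [c [d [h5 h6 h7 h8]]] := rr x2.
  exists ((a, b), (c, d)) => //; rewrite /F; case: asboolP => [_|nh].
    by split; rewrite /= in_itv /= ?h1 ?h2 ?h5 ?h6.
  exfalso; apply: nh => -[y1 y2] [] /=; rewrite !in_itv /= => /andP[? ?] /andP[? ?].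
  by apply: he; split; rewrite /ball /= ltr_norml; apply/andP; split; lra.
apply: countable_bigcupT_measurable => [|q]; first exact: countableP.
rewrite /F; case: asboolP => // _.
by apply: measurableX; exact: measurable_itv.
Qed.

(** The measurable sets of the product are generated by the two projections; having the open sets as
    generators allows a Dynkin induction that starts from them. *)
Lemma measurable_plane_open : (@measurable _ (R * R)%type) = <<s @open pt >>.
Proof.
apply/seteqP; split; last first.
  apply: smallest_sub; first exact: sigma_algebra_measurable.
  by move=> U; exact: open_measurable_plane.
have H (g : g_sigma_algebraType (@open pt) -> R) : (continuous (g : pt -> R)) ->
    measurable_fun setT g.
  move=> cg; apply: (measurability (@RGenOpens.G R)).
    exact: RGenOpens.measurableE.
  move=> _ [_ [a [b ->]] <-]; rewrite setTI; apply: sub_sigma_algebra.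
  by apply: open_comp => // x _; exact: cg.
apply: smallest_sub; first exact: smallest_sigma_algebra.
move=> A [[B mB <-]|[B mB <-]].
  by apply: (H fst) => // x; exact: cvg_fst.
by apply: (H snd) => // x; exact: cvg_snd.
Qed.

Lemma closed_measurable_plane (C : set pt) : closed C -> measurable C.
Proof.
by move=> cC; rewrite -(setCK C); apply: measurableC; apply: open_measurable_plane;
  exact: closed_openC.
Qed.

Lemma continuous_measurable_plane (g : pt -> R) : continuous g -> measurable_fun setT g.
Proof.
move=> cg; apply: (measurability (@RGenOpens.G R)).
  exact: RGenOpens.measurableE.
move=> _ [_ [a [b ->]] <-]; rewrite setTI; apply: open_measurable_plane.
by apply: open_comp => // x _; exact: cg.
Qed.

Lemma gasket_map_measurable i : measurable_fun setT (fm i : pt -> pt).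
Proof.
have -> : (fm i : pt -> pt) = (fun x => (2^-1 * (x.1 + (p i).1), 2^-1 * (x.2 + (p i).2))) by [].
apply: measurable_fun_pair; apply: measurable_funM => //; apply: measurable_funD => //.
Qed.

Lemma wmap_measurable w : measurable_fun setT (wmap w).
Proof.
elim: w => [|i w IH] /=; first exact: measurable_id.
by apply: measurableT_comp; [exact: gasket_map_measurable|].
Qed.

Lemma Kmeasurable : measurable K.
Proof. by apply: closed_measurable_plane; exact: Kclosed. Qed.

Lemma cell_closed w : closed (wmap w @` K).
Proof.
apply: compact_closed; first exact: norm_hausdorff.
apply: continuous_compact; last exact: Kcompact.
by apply: continuous_subspaceT; exact: wmap_continuous.
Qed.

Lemma cell_measurable w : measurable (wmap w @` K).
Proof. by apply: closed_measurable_plane; exact: cell_closed. Qed.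

Section Measure.
Variable nu : probability (R * R)%type R.
Hypothesis hnu : normalized_hausdorff (gasket_dim R) K nu.

Lemma nuK : nu K = 1%E.
Proof.
have := hnu measurableT; rewrite setTI probability_setT => ->.
by rewrite (hnu Kmeasurable) setIid.
Qed.

Lemma nu_notK : nu (~` K) = 0%E.
Proof. by rewrite probability_setC ?nuK ?subee //; exact: Kmeasurable. Qed.

Lemma nu_IK A : measurable A -> nu (A `&` K) = nu A.
Proof.
move=> mA; rewrite (hnu mA) (hnu (measurableI _ _ mA Kmeasurable)).
by rewrite -setIA setIid.
Qed.

Lemma measurable_preimage w A : measurable A -> measurable (wmap w @^-1` A).
Proof. by move=> mA; rewrite -[_ @^-1` _]setTI; exact: wmap_measurable. Qed.

(** f_i maps the part of the preimage in K onto the part of A in the cell, and divides its Hausdorff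
    measure by 3. *)
Lemma nu_preimage1 i A : measurable A ->
  nu (fm i @^-1` A) = (3%:E * nu (A `&` fm i @` K))%E.
Proof.
move=> mA; have mA' := @measurable_preimage [:: i] A mA.
have mB : measurable (A `&` fm i @` K).
  by apply: measurableI => //; exact: (@cell_measurable [:: i]).
rewrite (hnu mA') (hnu mB) (hausdorff_map i) muleA; congr (_ * hausdorff _ _ * _)%E.
apply/seteqP; split => [_ [x [/= Ax Kx] <-]|x [[Ax [y Ky e]] Kx]].
  by split; [split => //; exists x|exact: K_map].
by exists y => //; split => //=; rewrite /preimage /= e.
Qed.

Lemma nu_preimage w A : measurable A ->
  nu (wmap w @^-1` A) = ((3 ^+ size w)%:E * nu (A `&` wmap w @` K))%E.
Proof.
elim: w A => [|i w IH] A mA.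
  by rewrite mul1e (_ : wmap [::] @` K = K) ?image_id // nu_IK.
have -> : wmap (i :: w) @^-1` A = wmap w @^-1` (fm i @^-1` A) by [].
rewrite IH; last exact: (@measurable_preimage [:: i]).
have -> : fm i @^-1` A `&` wmap w @` K =
    fm i @^-1` (A `&` wmap (i :: w) @` K).
  apply/seteqP; split => x [/= Ax [y Ky e]]; split => //.
    by exists y => //=; rewrite e.
  by exists y => //; apply: gasket_map_inj e.
rewrite nu_preimage1; last by apply: measurableI => //; exact: cell_measurable.
rewrite muleA -EFinM -exprSr -setIA; congr (_ * nu (_ `&` _))%E.
apply/setIidl => _ [y Ky <-]; exists (wmap w y) => //; exact: K_wmap.
Qed.

Lemma nu_cell w : nu (wmap w @` K) = (3^-1 ^+ size w)%:E.
Proof.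
have := nu_preimage w measurableT; rewrite setTI preimage_setT probability_setT.
have n3 : (3 : R) ^+ size w != 0 by rewrite expf_neq0 // pnatr_eq0.
have -> : nu (wmap w @` K) = (fine (nu (wmap w @` K)))%:E.
  by rewrite fineK // fin_num_measure //; exact: cell_measurable.
rewrite -EFinM => -[e]; congr _%:E; rewrite exprVn; apply: (mulfI n3).
by rewrite -e mulfV.
Qed.

Lemma integral_comp_ge0 w (f : pt -> \bar R) : measurable_fun setT f ->
  (forall x, 0 <= f x)%E ->
  (\int[nu]_x f (wmap w x) = (3 ^+ size w)%:E * \int[nu]_(x in wmap w @` K) f x)%E.
Proof.
move=> mf f0; set g := wmap w; set D := g @` K.
have mg : measurable_fun setT g by exact: wmap_measurable.
have mD : measurable D by exact: cell_measurable.
have h3 : 0 <= (3 : R) ^+ size w by rewrite exprn_ge0.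
have mgD : measurable (g @^-1` D) by exact: measurable_preimage.
transitivity (\int[nu]_(x in g @^-1` D) f (g x))%E.
  (* The preimage of the cell contains K, so only a null set is cut off. On subsets of the cell the
     image of [nu] under f_w is then 3^n times [nu]. *)
  rewrite (@ge0_negligible_integral _ _ _ nu setT (~` (g @^-1` D))) //.
  - by rewrite setTD setCK.
  - exact: measurableC.
  - exact: measurableT_comp.
  - apply: (@subset_measure0 _ _ _ nu _ (~` K)); last exact: nu_notK.
    + exact: measurableC.
    + by apply: measurableC; exact: Kmeasurable.
    + by move=> x /= nD Kx; apply: nD; exists x.
rewrite -(@ge0_integral_pushforward _ _ _ _ _ g mg nu D f) //; last first.
- exact: measurable_funTS.
rewrite (@eq_measure_integral _ _ _ D (mscale (NngNum h3) nu)).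
  by rewrite ge0_integral_mscale //; exact: measurable_funTS.
move=> A mA AD; transitivity (nu (wmap w @^-1` A)) => //.
rewrite (nu_preimage w mA) /mscale /=.
by congr (_ * nu _)%E; apply/setIidl.
Qed.

(** * Square integrable functions and their averages *)

Notation L2 u := (u \in Lfun nu 2%:E).
Notation int1 u := (nu.-integrable setT (EFin \o u)).

Definition avg (u : pt -> R) : R := \int[nu]_x u x.

Lemma L2_measurable u : L2 u -> measurable_fun setT u.
Proof. by move=> /andP[mu _]; rewrite inE in mu. Qed.

Lemma L2P u : L2 u <-> measurable_fun setT u /\ int1 (fun x => u x ^+ 2).
Proof.
split=> [h|[mu iu]]; first by split; [exact: L2_measurable|exact: Lfun2_integrable_sqr].
apply/andP; split; first by rewrite inE.
rewrite inE /= /finite_norm unlock /=; apply: poweR_lty.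
have /integrableP[_] := iu; apply: le_lt_trans; apply: ge0_le_integral => //.
- apply/measurable_EFinP; apply: (@measurableT_comp _ _ _ _ _ _ (@powR R ^~ 2)) => //.
  exact: measurableT_comp.
- by apply: measurableT_comp => //; apply/measurable_EFinP; exact: measurable_funX.
- by move=> x _; rewrite lee_fin powR_mulrn // normrX.
Qed.

Lemma L2_lin a u v : L2 u -> L2 v -> L2 (a *: u + v).
Proof.
move=> hu hv; have h12 : (1 <= 2%:E :> \bar R)%E by rewrite lee_fin ler1n.
by have [_ h] := Lfun_submod_closed nu h12; exact: (h a u v).
Qed.

Lemma L2_cst c : L2 (cst c : pt -> R).
Proof. exact: Lfun_cst. Qed.

Lemma L2_sub u v : L2 u -> L2 v -> L2 (u - v).
Proof.
by move=> hu hv; rewrite addrC -scaleN1r; exact: L2_lin.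
Qed.

Lemma L2_int u : L2 u -> int1 u.
Proof.
move=> hu; apply/Lfun1_integrable; apply: Lfun_subset12 => //.
exact: fin_num_measure.
Qed.

Lemma L2_mul u v : L2 u -> L2 v -> int1 (fun x => u x * v x).
Proof. by move=> hu hv; apply/Lfun1_integrable; exact: Lfun2_mul_Lfun1. Qed.

Lemma linE a (u v : pt -> R) x : (a *: u + v) x = a * u x + v x.
Proof. by []. Qed.

Lemma subE (u v : pt -> R) x : (u - v) x = u x - v x.
Proof. by []. Qed.

Lemma int1_lin a u v : int1 u -> int1 v -> int1 (a *: u + v).
Proof.
move=> /Lfun1_integrable iu /Lfun1_integrable iv; apply/Lfun1_integrable.
have h11 : (1 <= 1%:E :> \bar R)%E by [].
by have [_ h] := Lfun_submod_closed nu h11; exact: (h a u v).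
Qed.

Lemma L2_sqr u : L2 u -> int1 (fun x => u x ^+ 2).
Proof. by move/L2P => []. Qed.

Lemma int1_bounded (u : pt -> R) (M : R) : measurable_fun setT u -> (forall x, `|u x| <= M) -> int1 u.
Proof.
move=> mu hM; apply: (@le_integrable _ _ _ nu setT measurableT _ (cst M%:E)).
- exact/measurable_EFinP.
- move=> x _; rewrite /= lee_fin (le_trans (hM x)) //.
  by rewrite ler_norm.
- by apply: finite_measure_integrable_cst.
Qed.

Lemma L2_bounded (u : pt -> R) (M : R) : measurable_fun setT u -> (forall x, `|u x| <= M) -> L2 u.
Proof.
move=> mu hM; apply/L2P; split => //.
apply: (@int1_bounded _ (M ^+ 2)); first exact: measurable_funX.
by move=> x; rewrite normrX lerXn2r ?nnegrE // (le_trans _ (hM x)).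
Qed.

Lemma integrable_comp w u : int1 u -> int1 (u \o wmap w).
Proof.
move=> /integrableP[mu iu]; apply/integrableP; split.
  by apply: (@measurableT_comp _ _ _ _ _ _ (EFin \o u)) => //; exact: wmap_measurable.
rewrite (_ : (fun x => _) = (fun x => (fun y => `|(u y)%:E|%E) (wmap w x))) //.
rewrite (@integral_comp_ge0 w (fun y => `|(u y)%:E|%E)) //; last exact: measurableT_comp.
rewrite lte_mul_pinfty ?lee_fin ?exprn_ge0 //; apply: le_lt_trans iu.
apply: ge0_subset_integral => //; first exact: cell_measurable.
exact: measurableT_comp.
Qed.

Lemma L2_comp w u : L2 u -> L2 (u \o wmap w).
Proof.
move=> /L2P[mu iu]; apply/L2P; split.
  by apply: measurableT_comp => //; exact: wmap_measurable.
exact: (integrable_comp w iu).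
Qed.

Lemma avg_comp w u : int1 u ->
  avg (u \o wmap w) = 3 ^+ size w * \int[nu]_(x in wmap w @` K) u x.
Proof.
move=> iu; rewrite /avg /Rintegral integralE.
have /integrableP[mu _] := iu.
have mD := cell_measurable w.
rewrite (_ : (fun x => _)^\+%E = (EFin \o u)^\+%E \o wmap w); last first.
  by apply/funext => x; rewrite /= !funeposE.
rewrite (_ : (fun x => _)^\-%E = (EFin \o u)^\-%E \o wmap w); last first.
  by apply/funext => x; rewrite /= !funenegE.
rewrite (@integral_comp_ge0 w _ (measurable_funepos mu)) //.
rewrite (@integral_comp_ge0 w _ (measurable_funeneg mu)) //.
have iD : nu.-integrable (wmap w @` K) (EFin \o u) by exact: integrableS iu.
have f1 := integrable_pos_fin_num mD iD; have f2 := integrable_neg_fin_num mD iD.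
rewrite -muleBr //; last by rewrite fin_num_adde_defl // fin_numN.
rewrite fineM //; last by rewrite fin_numB f1 f2.
by rewrite -integralE.
Qed.

Lemma avgK u : int1 u -> avg u = \int[nu]_(x in K) u x.
Proof.
move=> iu; have := @avg_comp [::] u iu; rewrite mul1r => e.
by rewrite (_ : wmap [::] @` K = K) ?image_id // in e.
Qed.

Lemma cell_avgE n (w : n.-tuple 'I_3) u : int1 u ->
  cell_avg K nu u w = avg (u \o wmap w).
Proof.
move=> iu; rewrite avg_comp // /cell_avg (nu_cell w) /=.
by rewrite exprVn invrK.
Qed.

(** The preimage under f_i of the intersection lies in {p_j}. A fixed point p_k satisfies nu {p_k} =
    3 nu {p_k} with a finite value, so it is a null set. *)
Lemma nu_cell_meet i j : i != j -> nu (fm i @` K `&` fm j @` K) = 0%E.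
Proof.
move=> ij.
have cl (x : pt) : measurable [set x].
  by apply: closed_measurable_plane; apply: accessible_closed_set1;
    exact: hausdorff_accessible (@norm_hausdorff _ _).
have p0 k : nu [set p k] = 0%E.
  have := nu_preimage1 k (cl (p k)).
  have -> : fm k @^-1` [set p k] = [set p k].
    apply/seteqP; split => x /=; last by move=> ->; rewrite gasket_map_pt.
    by move=> e; apply: (@gasket_map_inj k); rewrite gasket_map_pt.
  have -> : [set p k] `&` fm k @` K = [set p k].
    apply/setIidl => _ ->; exists (p k); [exact: K_pt|exact: gasket_map_pt].
  have : nu [set p k] \is a fin_num by exact: fin_num_measure.
  by move=> /fineK <-; rewrite -EFinM => -[e]; congr _%:E; lra.
have mij : measurable (fm i @` K `&` fm j @` K).
  by apply: measurableI; [exact: (@cell_measurable [:: i])|exact: (@cell_measurable [:: j])].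
have := nu_preimage1 i mij.
rewrite (@subset_measure0 _ _ _ nu (fm i @^-1` (fm i @` K `&` fm j @` K)) [set p j]) //.
- rewrite (_ : _ `&` _ `&` _ = fm i @` K `&` fm j @` K); last first.
    by rewrite setIAC setIid.
  by move=> /esym/eqP; rewrite mule_eq0 eqe pnatr_eq0 /= => /eqP.
- exact: (@measurable_preimage [:: i]).
- by move=> x /= [[y Ky /gasket_map_inj <-] [z Kz /esym/(K_meet Ky Kz ij)[]]].
- exact: p0.
Qed.

Lemma avgS u : int1 u -> avg u = 3^-1 * \sum_(i < 3) avg (u \o fm i).
Proof.
move=> iu.
have mc i : measurable (fm i @` K) by exact: (@cell_measurable [:: i]).
have ec i : avg (u \o fm i) = 3 * \int[nu]_(x in fm i @` K) u x.
  by have := avg_comp [:: i] iu.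
rewrite sum3E !ec avgK //.
set D0 := fm i0 @` K; set D1 := fm i1 @` K; set D2 := fm i2 @` K.
(* The cells overlap in null sets; removing the overlaps gives a partition on which the integral is
   additive. *)
have KE : K = D0 `|` (D1 `\` D0 `|` D2 `\` (D0 `|` D1)).
  apply/seteqP; split => [x Kx|x].
    have [i [y [Ky ->]]] := K_ind Kx.
    have hD : (D0 `|` D1 `|` D2) (fm i y).
      by elim/I3P: i; [left; left|left; right|right]; exists y.
    case: (pselect (D0 (fm i y))) => h0; first by left.
    case: (pselect (D1 (fm i y))) => h1; first by right; left.
    by right; right; split => [|[]//]; case: hD => [[]|].
  by move=> [h|[[h _]|[h _]]]; move: h => [y Ky <-]; exact: K_map.
have subI D : measurable D -> nu.-integrable D (EFin \o u).
  by move=> mD; exact: integrableS iu.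
have nI D N : measurable D -> measurable N -> nu (D `&` N) = 0%E ->
    \int[nu]_(x in D) u x = \int[nu]_(x in D `\` N) u x.
  move=> mD mN h; rewrite /Rintegral (@negligible_integral _ _ _ nu D (D `&` N)) //.
  - by rewrite setDIr setDv set0U.
  - exact: measurableI.
  - exact: subI.
have mD0 : measurable D0 by exact: mc.
have mD1 : measurable D1 by exact: mc.
have mD2 : measurable D2 by exact: mc.
have m10 : measurable (D1 `\` D0) by exact: measurableD.
have m2 : measurable (D2 `\` (D0 `|` D1)) by apply: measurableD => //; exact: measurableU.
rewrite KE Rintegral_setU //; last first.
- by apply/disj_setPS => x [h [[_ h']|[_ h']]]; apply: h' => //; left.
- by apply: subI; apply: measurableU => //; exact: measurableU.
- exact: measurableU.
rewrite Rintegral_setU //; last first.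
- by apply/disj_setPS => x [[h _] [_ h']]; apply: h'; right.
- by apply: subI; exact: measurableU.
rewrite (nI D1 D0) ?nu_cell_meet // (nI D2 (D0 `|` D1)) ?nu_cell_meet //; first lra.
- exact: measurableU.
- rewrite setIUr; apply/eqP; rewrite eq_le measure_ge0 andbT.
  apply: le_trans (measureU2 _ _ _) _; rewrite /=; try exact: measurableI.
  by rewrite !nu_cell_meet // adde0.
Qed.

Lemma avgD a u v : int1 u -> int1 v -> avg (a *: u + v) = a * avg u + avg v.
Proof.
move=> iu iv; rewrite /avg -RintegralZl // -RintegralD //.
have -> : EFin \o (fun x => a * u x) = (fun x => a%:E * (u x)%:E)%E by [].
exact: integrableZl.
Qed.

Lemma avg_cst c : avg (cst c) = c.
Proof. rewrite /avg Rintegral_cst //; transitivity (c * fine (1%E : \bar R)).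
  by congr (_ * fine _); exact: probability_setT.
by rewrite mulr1. Qed.

Lemma avg_le u v : int1 u -> int1 v -> (forall x, K x -> u x <= v x) -> avg u <= avg v.
Proof.
move=> iu iv h; rewrite !avgK //; have mK := Kmeasurable.
by apply: le_Rintegral => //; apply: integrableS measurableT _ _ _.
Qed.

Lemma int1_cst c : int1 (cst c : pt -> R).
Proof. exact: finite_measure_integrable_cst. Qed.

Lemma avg_dist u c m : int1 u -> (forall x, K x -> `|u x - c| <= m) -> `|avg u - c| <= m.
Proof.
move=> iu h.
have h1 : avg u <= avg (cst (c + m)).
  apply: avg_le => // [|x /h]; first exact: int1_cst.
  by rewrite ler_norml /= => /andP[? ?]; lra.
have h2 : avg (cst (c - m)) <= avg u.
  apply: avg_le => // [|x /h]; first exact: int1_cst.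
  by rewrite ler_norml /= => /andP[? ?]; lra.
by rewrite !avg_cst in h1 h2; rewrite ler_norml; apply/andP; split; lra.
Qed.

Lemma avg_ae u v : measurable_fun setT u -> measurable_fun setT v ->
  u = v %[ae nu] -> avg u = avg v.
Proof.
move=> mu mv h; rewrite /avg /Rintegral; congr fine.
apply: ae_eq_integral => //; try exact/measurable_EFinP.
by apply: filterS h => x h /h /= ->.
Qed.

Lemma avg_sqr_ge0 u : 0 <= avg (fun x => u x ^+ 2).
Proof. by apply: Rintegral_ge0 => x _; exact: sqr_ge0. Qed.

Lemma ae_preimage i (P : pt -> Prop) : {ae nu, forall x, P x} ->
  {ae nu, forall x, P (fm i x)}.
Proof.
move=> [N [mN N0 hN]]; exists (fm i @^-1` N); split.
- exact: (@measurable_preimage [:: i]).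
- rewrite nu_preimage1 // (@subset_measure0 _ _ _ nu _ N) ?mule0 //.
  by apply: measurableI => //; exact: (@cell_measurable [:: i]).
- by move=> x /= nP; apply: hN.
Qed.

Lemma L2norm_sqr u : L2 u -> L2norm nu u ^+ 2 = avg (fun x => u x ^+ 2).
Proof.
move=> hu; rewrite /L2norm unlock /= fine_poweR.
have e : (\int[nu]_x `|(EFin \o u) x| `^ 2 = \int[nu]_x (u x ^+ 2)%:E)%E.
  apply: eq_integral => x _; rewrite poweR_EFin powR_mulrn ?normr_ge0 //.
  by rewrite real_normK ?num_real.
rewrite e -powR_mulrn ?powR_ge0 // -powRrM mulVf ?pnatr_eq0 // powRr1 //.
exact: avg_sqr_ge0.
Qed.

Lemma L2norm_ge0 u : 0 <= L2norm nu u.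
Proof. by rewrite /L2norm fine_ge0 // Lnorm_ge0. Qed.

(** * Energies of cell averages *)

Definition cell_energy (u : pt -> R) (n : nat) : R :=
  (5 / 3) ^+ n * word_energy (fun w => avg (u \o wmap w)) n.

Lemma avg_energyE u n : int1 u -> avg_energy K nu u n = cell_energy u n.
Proof.
move=> iu; rewrite /avg_energy /cell_energy /word_energy; congr (_ * _).
apply: eq_big => [w|w _]; first exact: neighborP.
by rewrite !cell_avgE.
Qed.

Lemma word_energy_ge0 (c : seq 'I_3 -> R) n : 0 <= word_energy c n.
Proof. by apply: sumr_ge0 => w _; exact: sqr_ge0. Qed.

Lemma cell_energy_ge0 u n : 0 <= cell_energy u n.
Proof. by rewrite mulr_ge0 ?word_energy_ge0 // exprn_ge0 //; lra. Qed.

(** The second summand, from neighbors in different cells of level 1, is the failure of exact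
    self-similarity. *)
Lemma cell_energyS u n : cell_energy u n.+1 = 5 / 3 * \sum_(i < 3) cell_energy (u \o fm i) n +
  (5 / 3) ^+ n.+1 * \sum_(i < 3) \sum_(j < 3 | i != j)
     (avg ((u \o fm i) \o wmap (nseq n j)) - avg ((u \o fm j) \o wmap (nseq n i))) ^+ 2.
Proof. by rewrite /cell_energy word_energyS mulrDr -mulr_sumr exprS -mulrA. Qed.

Lemma sum3neqE (F : 'I_3 -> 'I_3 -> R) :
  \sum_(i < 3) \sum_(j < 3 | i != j) F i j =
  F i0 i1 + F i0 i2 + (F i1 i0 + F i1 i2) + (F i2 i0 + F i2 i1).
Proof.
have h i : \sum_(j < 3 | i != j) F i j = \sum_(j < 3) if i != j then F i j else 0.
  exact: big_mkcond.
by rewrite sum3E !h !sum3E /= !add0r !addr0.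
Qed.

Definition corner_defect (v : pt -> R) : R := \sum_(j < 3) (avg v - v (p j)) ^+ 2.

(* The corner terms on the left leave room in the induction for the pairs of
   neighbors that lie in different cells of level 1. *)
Lemma cell_energy_le_defect u n :
  cell_energy u n + 4 * ((5 / 3) ^+ n * \sum_(j < 3) (avg (u \o wmap (nseq n j)) - u (p j)) ^+ 2)
  <= 4 * iterS n corner_defect u.
Proof.
elim: n u => [|n IH] u; first by rewrite /cell_energy word_energy0 mulr0 add0r mul1r.
have h0 := IH (u \o fm i0); have h1 := IH (u \o fm i1); have h2 := IH (u \o fm i2).
rewrite cell_energyS [iterS n.+1 _ _]/= sum3neqE.
move: h0 h1 h2; rewrite !sum3E /= !gasket_map_pt (exprS _ n).
rewrite (gasket_map_swap i1 i0) (gasket_map_swap i2 i0) (gasket_map_swap i2 i1).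
have : 0 <= (5 / 3 : R) ^+ n by rewrite exprn_ge0 //; lra.
rewrite -![(u \o fm _) \o wmap _]/(u \o (fm _ \o wmap _)).
set t := _ ^+ n; set x00 := avg _; set x01 := avg _; set x02 := avg _.
set y0 := u _; set y1 := u (fm i0 _); set y2 := u (fm i0 _).
set x10 := avg _; set x11 := avg _; set x12 := avg _.
set z1 := u _; set z2 := u (fm i1 _).
set x20 := avg _; set x21 := avg _; set x22 := avg _.
set w2 := u _.
set D0 := cell_energy _ _; set D1 := cell_energy _ _; set D2 := cell_energy _ _.
set S0 := iterS _ _ _; set S1 := iterS _ _ _; set S2 := iterS _ _ _.
move: t x00 x01 x02 y0 y1 y2 x10 x11 x12 z1 z2 x20 x21 x22 w2 D0 D1 D2 S0 S1 S2.
move=> t x00 x01 x02 y0 y1 y2 x10 x11 x12 z1 z2 x20 x21 x22 w2 D0 D1 D2 S0 S1 S2 t0 h0 h1 h2.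
(* [c] is the value at the common corner of the two cells. As each unordered pair is summed twice,
   every inner corner receives a factor 2 * 2, which is the constant 4 of the statement; the three
   outer corners are left over for the next level. *)
have sq (a b c : R) : t * (a - b) ^+ 2 <= t * (2 * (a - c) ^+ 2 + 2 * (b - c) ^+ 2).
  by rewrite ler_wpM2l //; have := sqr_ge0 (a + b - 2 * c); lra.
have := sq x01 x10 y1; have := sq x02 x20 y2; have := sq x12 x21 z2.
by lra.
Qed.

Lemma defect_le v : uc v -> int1 v -> bounded_en v -> corner_defect v <= 300 * limit_energy v.
Proof.
move=> uv iv bv; have q0 := limit_energy_ge0 bv.
pose m := Num.sqrt (limit_energy v).
have m0 : 0 <= m by exact: sqrtr_ge0.
have mq : m ^+ 2 = limit_energy v by rewrite sqr_sqrtr.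
have hm n : en n v v <= m ^+ 2 by rewrite mq; exact: en_le_limit.
have h j : (avg v - v (p j)) ^+ 2 <= 100 * limit_energy v.
  have : `|avg v - v (p j)| <= 10 * m.
    by apply: avg_dist => // x Kx; exact: osc_en hm _ _ _.
  rewrite -mq (_ : (avg v - v (p j)) ^+ 2 = `|avg v - v (p j)| ^+ 2) => [h|]; last first.
    by rewrite real_normK ?num_real.
  have -> : 100 * m ^+ 2 = (10 * m) ^+ 2 by ring.
  by rewrite lerXn2r ?nnegrE // mulr_ge0.
by rewrite /corner_defect sum3E; have := h i0; have := h i1; have := h i2; lra.
Qed.

Lemma iterS_defect_le n v : uc v -> int1 v -> bounded_en v ->
  iterS n corner_defect v <= 300 * limit_energy v.
Proof.
elim: n v => [|n IH] v uv iv bv; first exact: defect_le.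
have h i : iterS n corner_defect (v \o fm i) <= 300 * limit_energy (v \o fm i).
  apply: IH; [exact: uc_sub|exact: (integrable_comp [:: i])|exact: bounded_en_sub].
rewrite limit_energyS //= !sum3E; have := h i0; have := h i1; have := h i2; lra.
Qed.

(** 1200 is 4 times 3 * 10^2: each cell has three corners, where the value differs from the average
    by at most 10 times the root of the energy, and the limit energies of the cells add up
    exactly. *)
Lemma cell_energy_le v n : uc v -> int1 v -> bounded_en v -> cell_energy v n <= 1200 * limit_energy v.
Proof.
move=> uv iv bv; have := cell_energy_le_defect v n; have := iterS_defect_le n uv iv bv.
set S := \sum_(j < 3) _; have : 0 <= (5 / 3) ^+ n * S.
  by rewrite mulr_ge0 ?exprn_ge0 ?sumr_ge0 // => i _; exact: sqr_ge0.
by lra.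
Qed.

(** The telescoping quantity: it vanishes for m = 0, and for continuous u it tends to the sum of the
    squared differences of corner values and average as m grows. *)
Definition corner_avg (m : nat) (u : pt -> R) : R :=
  \sum_(i < 3) (avg (u \o wmap (nseq m i)) - avg u) ^+ 2.

Definition children_defect (u : pt -> R) : R :=
  \sum_(i < 3) (avg (u \o fm i) - avg u) ^+ 2.

(* (x + y)^2 <= 5/4 x^2 + 5 y^2, and 5/4 = 3/4 * 5/3. *)
Lemma iterS_corner_avgS n m u : iterS n (corner_avg m.+1) u <=
  3 / 4 * iterS n.+1 (corner_avg m) u + 5 * iterS n children_defect u.
Proof.
elim: n u => [|n IH] u; last first.
  have := IH (u \o fm i0); have := IH (u \o fm i1); have := IH (u \o fm i2).
  rewrite [iterS n.+1 (corner_avg m.+1) u]/= [iterS n.+2 _ u]/= [iterS n.+1 children_defect _]/=.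
  by rewrite !sum3E /= !sum3E; lra.
rewrite /= /corner_avg /children_defect mulrA.
have -> : 3 / 4 * (5 / 3) = 5 / 4 :> R by field.
rewrite !mulr_sumr -big_split /=; apply: ler_sum => i _.
rewrite mulr_sumr (bigD1 i) //= -[(u \o fm i) \o wmap _]/(u \o (fm i \o wmap _)).
set a := avg _; set b := avg _; set c := avg _; set S := \sum_(j < 3 | _) _.
have : 0 <= S by apply: sumr_ge0 => j _; rewrite mulr_ge0 ?sqr_ge0 //; lra.
by have := sqr_ge0 ((a - c) - 4 * (c - b)); lra.
Qed.

(** The average over a cell is the mean of those over its children, so its distance to them is
    controlled by differences of siblings, which are neighbors; all other pairs of neighbors are
    dropped. *)
Lemma iterS_children_le n u : int1 u -> iterS n children_defect u <= cell_energy u n.+1.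
Proof.
elim: n u => [|n IH] u iu; last first.
  have h i : iterS n children_defect (u \o fm i) <= cell_energy (u \o fm i) n.+1.
    by apply: IH; exact: (integrable_comp [:: i]).
  rewrite cell_energyS /= !sum3E; have := h i0; have := h i1; have := h i2.
  set X := (5 / 3) ^+ n.+2 * _; suff : 0 <= X by lra.
  rewrite mulr_ge0 ?exprn_ge0 ?addr_ge0 //.
  - by apply: sumr_ge0 => j _; exact: sqr_ge0.
  - by apply: sumr_ge0 => j _; exact: sqr_ge0.
  - by apply: sumr_ge0 => j _; exact: sqr_ge0.
rewrite cell_energyS sum3neqE /= /children_defect (avgS iu) !sum3E expr1.
set a := avg _; set b := avg _; set c := avg _.
rewrite /cell_energy !word_energy0.
by have := sqr_ge0 (a - b); have := sqr_ge0 (b - c); have := sqr_ge0 (a - c); lra.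
Qed.

(** 20 solves 3/4 x + 5 = x. Lowering m by one raises the level n by one, so the induction on m
    needs the bound for all n at once. *)
Lemma iterS_corner_avg_le u M : int1 u -> (forall n, cell_energy u n.+1 <= M) ->
  forall m n, iterS n (corner_avg m) u <= 20 * M.
Proof.
move=> iu hM; have M0 : 0 <= M by apply: le_trans (hM 0%N); exact: cell_energy_ge0.
elim=> [|m IH] n.
  have -> : iterS n (corner_avg 0) u = 0; last lra.
  elim: n u {iu hM} => [|n IH] u /=; last by rewrite big1 ?mulr0.
  by rewrite /corner_avg big1 // => i _; rewrite subrr expr0n.
have := iterS_corner_avgS n m u; have := IH n.+1; have := hM n.
by have := iterS_children_le n iu; lra.
Qed.

Lemma cvg_corner_avg u : uc u -> int1 u ->
  (fun m => corner_avg m u) @ \oo --> \sum_(i < 3) (u (p i) - avg u) ^+ 2.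
Proof.
move=> uu iu.
have hc i : (fun m => avg (u \o wmap (nseq m i))) @ \oo --> u (p i).
  apply/cvgrPdist_le => e e_gt0; have [N hN] := uu e e_gt0.
  exists N => // n /= Nn; rewrite distrC; apply: avg_dist.
    exact: integrable_comp.
  move=> x Kx; have := hN (nseq n i) x (p i).
  by rewrite size_nseq wmap_nseq => /(_ Nn Kx (K_pt i)) /ltW.
have hs i : (fun m => (avg (u \o wmap (nseq m i)) - avg u) ^+ 2) @ \oo -->
    (u (p i) - avg u) ^+ 2.
  apply: (@cvgM _ _ \oo _ (fun m => avg (u \o wmap (nseq m i)) - avg u)
    (fun m => avg (u \o wmap (nseq m i)) - avg u)).
    by apply: cvgB; [exact: hc|exact: cvg_cst].
  by apply: cvgB; [exact: hc|exact: cvg_cst].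
rewrite sum3E /corner_avg; under eq_fun do rewrite sum3E.
by apply: cvgD; [apply: cvgD|].
Qed.

Lemma cvg_iterS_corner n u : uc u -> int1 u ->
  (fun m => iterS n (corner_avg m) u) @ \oo -->
  iterS n (fun v => \sum_(i < 3) (v (p i) - avg v) ^+ 2) u.
Proof.
elim: n u => [|n IH] u uu iu /=; first exact: cvg_corner_avg.
rewrite sum3E; under eq_fun do rewrite sum3E.
have h i := IH (u \o fm i) (uc_sub i uu) (integrable_comp [:: i] iu).
by apply: cvgM; [exact: cvg_cst|apply: cvgD; [apply: cvgD|]].
Qed.

Lemma en_le_cell_energy u M : uc u -> int1 u -> (forall n, cell_energy u n.+1 <= M) ->
  forall n, en n u u <= 240 * M.
Proof.
move=> uu iu hM n.
have h1 : iterS n (fun v => \sum_(i < 3) (v (p i) - avg v) ^+ 2) u <= 20 * M.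
  have hc := @cvg_iterS_corner n u uu iu.
  rewrite -(cvg_lim _ hc) //; apply: limr_le; first by apply/cvg_ex; eexists; exact: hc.
  by apply: nearW => m; exact: iterS_corner_avg_le.
(* The squared differences of three numbers sum to at most 3 times their squared deviations from any
   m, and [e0] counts each difference twice; so 12 leaves room, and 12 * 20 = 240. *)
suff : en n u u <= 12 * iterS n (fun v => \sum_(i < 3) (v (p i) - avg v) ^+ 2) u by lra.
elim: n u {uu iu hM h1} => [|n IH] u /=; last first.
  by rewrite !sum3E; have := IH (u \o fm i0); have := IH (u \o fm i1);
    have := IH (u \o fm i2); lra.
rewrite /e0 !sum3E /=; set a := u _; set b := u _; set c := u _; set m := avg _.
have := sqr_ge0 (a - m); have := sqr_ge0 (b - m); have := sqr_ge0 (c - m).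
by have := sqr_ge0 (a + b + c - 3 * m); lra.
Qed.

Lemma uc_continuous h : uc h -> {within K, continuous h}.
Proof.
move=> uh; apply/subspace_continuousP => x Kx.
apply/cvgrPdist_lt => e e_gt0; have [N hN] := uh e e_gt0.
(* There are finitely many cells of level N, and all are closed; so a point close to x meets only
   those that contain x, and shares a cell with x. *)
have H : \forall y \near nbhs x, forall w : N.-tuple 'I_3,
    ~ (wmap w @` K) x -> ~ (wmap w @` K) y.
  apply: filter_forall => w; case: (pselect ((wmap w @` K) x)) => [h1|h1].
    by apply: nearW => y.
  have : nbhs x (~` (wmap w @` K)).
    by apply: open_nbhs_nbhs; split => //; apply: closed_openC; exact: cell_closed.
  by apply: filterS => y hy.
rewrite near_withinE; apply: filterS H => y Hy Ky.
have [w [z [sw Kz e']]] := K_word N Ky.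
have sw' : size w == N by rewrite sw.
have [z' Kz' ex] : (wmap w @` K) x.
  by apply: contrapT => /(Hy (Tuple sw')); apply; exists z.
by rewrite -ex e'; apply: hN => //; rewrite sw.
Qed.

(** A Lebesgue number argument. [Q] is left open because it serves for small oscillation as well as
    for inclusion in an open set. *)
Lemma small_cells (C : set pt) (Q : set pt -> Prop) : compact C ->
  (forall x, C x -> exists2 d : R, 0 < d & forall A, A `<=` ball x d -> Q A) ->
  exists N, forall w, (N <= size w)%N -> (C `&` wmap w @` K !=set0) -> Q (wmap w @` K).
Proof.
move=> /compact_near_coveringP cC hQ.
have [|N _ hN] := cC nat \oo (fun n x' => forall w, (n <= size w)%N ->
    (wmap w @` K) x' -> Q (wmap w @` K)) _.
  move=> x Cx; have [d d_gt0 hd] := hQ x Cx.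
  have d2 : 0 < d / 2 by rewrite divr_gt0.
  have [N _ hN] : \forall n \near \oo, (2^-1 : R) ^+ n < d / 2.
    by have /cvgr0_norm_lt /(_ _ d2) := cvg_half; apply: filterS => n; exact: le_lt_trans (ler_norm _).
  exists (ball x (d / 2), [set n | (N <= n)%N]); first by split; [exact: nbhsx_ballx|exists N].
  move=> [x' n] [/= hx Nn] w nw [y Ky ey]; apply: hd => _ [z Kz <-].
  move: hx; rewrite -!ball_normE /= -ey => hx.
  have := cell_dist w Ky Kz; have := hN (size w) (leq_trans Nn nw) => h1 h2.
  have := ler_normD (x - wmap w y) (wmap w y - wmap w z); rewrite addrA subrK; lra.
by exists N => w Nw [x [Cx hx]]; exact: (hN N (leqnn N) x Cx w).
Qed.

Lemma continuous_uc h : {within K, continuous h} -> uc h.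
Proof.
move=> /subspace_continuousP ch e e_gt0.
have [|N hN] := @small_cells K
  (fun A => forall y z, A y -> A z -> K y -> K z -> `|h y - h z| < e) Kcompact.
  move=> x Kx; have e2 : 0 < e / 2 by rewrite divr_gt0.
  have /cvgrPdist_lt /(_ _ e2) := ch x Kx.
  rewrite /within /= => /nbhs_ballP[d /= d_gt0 hd]; exists d => // A hA y z Ay Az Ky Kz.
  have : `|h x - h y| < e / 2 := hd y (hA y Ay) Ky.
  have : `|h x - h z| < e / 2 := hd z (hA z Az) Kz.
  by rewrite !ltr_norml => /andP[? ?] /andP[? ?]; apply/andP; split; lra.
exists N => w x y Nw Kx Ky; apply: (hN w Nw); rewrite //.
- by exists (wmap w x); split; [exact: K_wmap|exists x].
- exact: K_wmap.
- exact: K_wmap.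
Qed.

Lemma uc_cst (c : R) : uc (cst c).
Proof. by move=> e e_gt0; exists 0%N => w x y *; rewrite /= subrr normr0. Qed.

Lemma uc_lin a u v : uc u -> uc v -> uc (a *: u + v).
Proof.
move=> uu uv e e_gt0.
have e1 : 0 < e / (2 * (`|a| + 1)) by rewrite divr_gt0 // mulr_gt0 // ltr_wpDl.
have e2 : 0 < e / 2 by rewrite divr_gt0.
have [N1 h1] := uu _ e1; have [N2 h2] := uv _ e2.
exists (maxn N1 N2) => w x y; rewrite geq_max => /andP[n1 n2] Kx Ky.
have := h1 w x y n1 Kx Ky; have := h2 w x y n2 Kx Ky.
have -> : (a *: u + v) (wmap w x) - (a *: u + v) (wmap w y) =
  a * (u (wmap w x) - u (wmap w y)) + (v (wmap w x) - v (wmap w y)).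
  by rewrite mulrBr opprD addrACA.
set s := u _ - _; set t := v _ - _ => ht hs.
apply: le_lt_trans (ler_normD _ _) _; rewrite normrM.
have : `|a| * `|s| <= e / 2.
  apply: (@le_trans _ _ ((`|a| + 1) * (e / (2 * (`|a| + 1))))).
    by apply: ler_pM => //; [lra|exact: ltW].
  have a1 : `|a| + 1 != 0 by rewrite gt_eqF // ltr_wpDl.
  by rewrite le_eqVlt; apply/orP; left; apply/eqP; field.
lra.
Qed.

Lemma uc_bounded h : uc h -> exists M : R, forall x, K x -> `|h x| <= M.
Proof.
move=> uh; have [N hN] := uh 1 ltr01.
exists (1 + \sum_(w : N.-tuple 'I_3) `|h (wmap w (p i0))|) => x Kx.
have [w [y [sw Ky ->]]] := K_word N Kx.
have sw' : size w == N by rewrite sw.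
have := hN w y (p i0); rewrite sw leqnn => /(_ isT Ky (K_pt i0)).
rewrite (bigD1 (Tuple sw')) //=; set S := \sum_(i | _) _.
have : 0 <= S by apply: sumr_ge0.
have := ler_normD (h (wmap w y) - h (wmap w (p i0))) (h (wmap w (p i0))).
by rewrite subrK; lra.
Qed.

Lemma restrict_K (h : pt -> R) x : K x -> (h \_ K) x = h x.
Proof. by move=> Kx; rewrite patchE mem_set. Qed.

Lemma eq_uc h k : {in K, h =1 k} -> uc h -> uc k.
Proof.
move=> hk uh e e_gt0; have [N hN] := uh e e_gt0; exists N => w x y Nw Kx Ky.
by rewrite -!hk ?inE; [exact: hN|exact: K_wmap|exact: K_wmap].
Qed.

(** [uc] leaves the values off K arbitrary, so measurability and boundedness on the plane are only
    guaranteed after extension by zero. *)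
Lemma uc_restrict h : uc h -> uc (h \_ K) /\ L2 (h \_ K).
Proof.
move=> uh; have ur : uc (h \_ K).
  by apply: eq_uc uh => x; rewrite inE => Kx; rewrite restrict_K.
split => //; have [M hM] := uc_bounded uh.
apply: (@L2_bounded _ (Num.max M 0)); last first.
  move=> x; rewrite patchE; case: ifPn => [|_]; last by rewrite normr0 le_max lexx orbT.
  by rewrite inE => /hM; rewrite le_max => ->.
apply/(measurable_restrictT _ Kmeasurable).
apply: (measurability (@RGenOpens.G R)); first exact: RGenOpens.measurableE.
move=> _ [_ [a [b ->]] <-].
have : open ((h : subspace K -> R) @^-1` `]a, b[%classic).
  by apply: open_comp => // x _; exact: (uc_continuous uh).
move=> /open_subspaceP[V oV e].
have e' : V `&` K = h @^-1` `]a, b[%classic `&` K := e.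
rewrite setIC -e'.
by apply: measurableI; [exact: open_measurable_plane|exact: Kmeasurable].
Qed.

(** If the values at x differ, then they differ on a whole small cell around x, which has positive
    measure. *)
Lemma eq_ae_uc h k (U : set pt) : uc h -> uc k -> open U ->
  {ae nu, forall y, (U `&` K) y -> h y = k y} ->
  forall x, (U `&` K) x -> h x = k x.
Proof.
move=> uh uk oU [N [mN N0 hN]] x [Ux Kx]; apply: contrapT => /eqP hk.
have d_gt0 : 0 < `|h x - k x| / 2 by rewrite divr_gt0 // normr_gt0 subr_eq0.
have [N1 h1] := uh _ d_gt0; have [N2 h2] := uk _ d_gt0.
have [|N3 h3] := @small_cells [set x] (fun A => A `<=` U) (@compact_set1 _ x).
  move=> _ ->; have /nbhs_ballP[d /= d0 hd] : nbhs x U by exact: open_nbhs_nbhs.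
  by exists d => // A hA; exact: subset_trans hd.
pose n := maxn N1 (maxn N2 N3).
have [w [z [sw Kz ex]]] := K_word n Kx.
have [n1 n2 n3] : [/\ (N1 <= size w)%N, (N2 <= size w)%N & (N3 <= size w)%N].
  by split; rewrite sw /n !leq_max leqnn ?orbT.
have hU : wmap w @` K `<=` U by apply: h3 => //; exists x; split => //; exists z.
have cN : wmap w @` K `<=` N.
  move=> _ [y Ky <-]; apply: hN => /= hky.
  have {}hky := hky (conj (hU _ (ex_intro2 _ _ y Ky erefl)) (K_wmap w Ky)).
  have := h1 w y z n1 Ky Kz; have := h2 w y z n2 Ky Kz; rewrite -ex hky.
  have := ler_normB (k (wmap w y) - h x) (k (wmap w y) - k x).
  have -> : k (wmap w y) - h x - (k (wmap w y) - k x) = - (h x - k x) by ring.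
  by rewrite normrN; lra.
have h0 : nu (wmap w @` K) = 0%E := subset_measure0 (cell_measurable w) mN cN N0.
by move: h0; rewrite nu_cell => -[] /eqP; rewrite expf_eq0 invr_eq0 pnatr_eq0 andbF.
Qed.

Lemma eq_ae_uc_K h k : uc h -> uc k -> h = k %[ae nu] -> {in K, h =1 k}.
Proof.
move=> uh uk hk x; rewrite inE => Kx.
apply: (@eq_ae_uc h k setT) => //; first exact: openT.
by apply: filterS hk => y hky _; exact: hky.
Qed.

(** * Density of continuous functions *)

Section Density.
Implicit Types (u v f : pt -> R).

Definition dense u := forall e : R, 0 < e ->
  exists v, [/\ uc v, L2 v & avg (fun x => (u x - v x) ^+ 2) <= e].

Lemma avg_sqr_split u v f : L2 u -> L2 v -> L2 f ->
  avg (fun x => (u x - f x) ^+ 2) <=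
  2 * avg (fun x => (u x - v x) ^+ 2) + 2 * avg (fun x => (v x - f x) ^+ 2).
Proof.
move=> hu hv hf.
have i1 := L2_sqr (L2_sub hu hv); have i2 := L2_sqr (L2_sub hv hf).
have i3 := L2_sqr (L2_sub hu hf); have iz := int1_cst 0.
have iw := int1_lin 2 i2 iz; have i4 := int1_lin 2 i1 iw.
apply: le_trans (avg_le i3 i4 _) _ => [x _|]; last by rewrite !avgD // avg_cst addr0.
rewrite !linE /= addr0.
have : ((u - f) x = (u - v) x + (v - f) x) by rewrite !subE; ring.
move=> ->; set a := (u - v) x; set b := (v - f) x.
by have := sqr_ge0 (a - b); lra.
Qed.

Lemma dense_closed u : L2 u -> (forall e : R, 0 < e -> exists v,
   [/\ dense v, L2 v & avg (fun x => (u x - v x) ^+ 2) <= e]) -> dense u.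
Proof.
move=> hu h e e_gt0; have e4 : 0 < e / 4 by rewrite divr_gt0.
have [v [dv hv huv]] := h _ e4; have [f [uf hf hvf]] := dv _ e4.
exists f; split => //; apply: le_trans (avg_sqr_split hu hv hf) _; lra.
Qed.

Lemma avg_dominated (f_ : nat -> pt -> R) g : (forall n, measurable_fun setT (f_ n)) ->
  int1 g -> (forall n x, `|f_ n x| <= g x) ->
  (forall x, (fun n => f_ n x) @ \oo --> (0 : R)) ->
  (fun n => avg (f_ n)) @ \oo --> (0 : R).
Proof.
move=> mf ig hg hf.
have mf' n : measurable_fun setT (EFin \o f_ n) by exact/measurable_EFinP.
have m0 : measurable_fun setT (cst 0%E : pt -> \bar R) by exact: measurable_cst.
have h1 : \forall x \ae nu, setT x ->
    (fun n => (EFin \o f_ n) x) @ \oo --> (cst 0%E : pt -> \bar R) x.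
  by apply: aeW => x _; apply: cvg_EFin; [exact: nearW|exact: hf].
have h2 : \forall x \ae nu, forall n, setT x -> (`|(EFin \o f_ n) x| <= (EFin \o g) x)%E.
  by apply: aeW => x n _; rewrite lee_fin.
have [_ _ h] := dominated_convergence measurableT mf' m0 h1 ig h2.
have : (fun n => fine (\int[nu]_x (f_ n x)%:E)%E) @ \oo --> fine (\int[nu]_x (0 : R)%:E).
  by apply: fine_cvg; move: h; rewrite /= integral0.
by rewrite integral0.
Qed.

Lemma dense_dominated u (v_ : nat -> pt -> R) g : L2 u -> (forall n, L2 (v_ n)) ->
  (forall n, dense (v_ n)) -> int1 g ->
  (forall n x, (u x - v_ n x) ^+ 2 <= g x) ->
  (forall x, (fun n => v_ n x) @ \oo --> u x) -> dense u.
Proof.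
move=> hu hv dv ig hg hc; apply: dense_closed => // e e_gt0.
have : (fun n => avg (fun x => (u x - v_ n x) ^+ 2)) @ \oo --> (0 : R).
  apply: (@avg_dominated (fun n x => (u x - v_ n x) ^+ 2) g) => //.
  - move=> n; apply: measurable_funX; apply: measurable_funB; exact: L2_measurable.
  - by move=> n x; rewrite ger0_norm ?sqr_ge0.
  - move=> x.
    have h : (fun n => u x - v_ n x) @ \oo --> (0 : R).
      by rewrite -(subrr (u x)); apply: cvgB; [exact: cvg_cst|exact: hc].
    have : (fun n => (u x - v_ n x) * (u x - v_ n x)) @ \oo --> (0 * 0 : R) by exact: cvgM.
    by rewrite mulr0.
move=> /cvgr0_norm_lt /(_ _ e_gt0) [N _ /(_ N (leqnn N)) hN].
by exists (v_ N); split => //; apply: le_trans (ltW hN); exact: ler_norm.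
Qed.

Lemma dense_uc u : uc u -> L2 u -> dense u.
Proof.
move=> uu hu e e_gt0; exists u; split => //.
rewrite (_ : (fun x => _) = cst 0) ?avg_cst ?ltW //.
by apply/funext => x; rewrite subrr expr0n.
Qed.

Lemma dense_lin a u v : L2 u -> L2 v -> dense u -> dense v -> dense (a *: u + v).
Proof.
move=> hu hv du dv e e_gt0; have e4 : 0 < e / 4 by rewrite divr_gt0.
have ea : 0 < e / (4 * (a ^+ 2 + 1)) by rewrite divr_gt0 // mulr_gt0 // ltr_wpDl ?sqr_ge0.
have [f [uf hf hvf]] := dv _ e4; have [k [uk hk huk]] := du _ ea.
exists (a *: k + f); split; [exact: uc_lin|exact: L2_lin|].
have h1 : L2 (a *: u + v) by exact: L2_lin.
have h2 : L2 (a *: k + v) by exact: L2_lin.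
have h3 : L2 (a *: k + f) by exact: L2_lin.
apply: le_trans (avg_sqr_split h1 h2 h3) _.
rewrite (_ : (fun x => ((a *: k + v) x - (a *: k + f) x) ^+ 2) = (fun x => (v x - f x) ^+ 2)); last first.
  by apply/funext => x; rewrite !linE; ring.
rewrite (_ : (fun x => ((a *: u + v) x - (a *: k + v) x) ^+ 2) =
    (a ^+ 2) *: (fun x => (u x - k x) ^+ 2) + cst 0); last first.
  by apply/funext => x; rewrite !linE /=; ring.
rewrite avgD ?avg_cst ?addr0; [|exact: (L2_sqr (L2_sub hu hk))|exact: int1_cst].
have : a ^+ 2 * avg (fun x => (u x - k x) ^+ 2) <= e / 4.
  apply: (@le_trans _ _ ((a ^+ 2 + 1) * (e / (4 * (a ^+ 2 + 1))))).
    by apply: ler_pM; rewrite ?sqr_ge0 ?avg_sqr_ge0 //; lra.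
  have a1 : a ^+ 2 + 1 != 0 by rewrite gt_eqF // ltr_wpDl ?sqr_ge0.
  by rewrite le_eqVlt; apply/orP; left; apply/eqP; field.
lra.
Qed.

Lemma L2_indic (A : set pt) : measurable A -> L2 (\1_A : pt -> R).
Proof.
move=> mA; apply: (@L2_bounded _ 1); first exact: measurable_indic.
by move=> x; rewrite indicE; case: (x \in A); rewrite ?normr1 ?normr0.
Qed.

Lemma dense_open (U : set pt) : open U -> dense (\1_U : pt -> R).
Proof.
(* The distance to the complement would be an infimum over the empty set if U were the whole
   plane. *)
move=> oU; case: (pselect (~` U !=set0)) => [[y0 y0U]|nU]; last first.
  have -> : (\1_U : pt -> R) = cst 1.
    apply/funext => x; rewrite indicE mem_set //.
    by apply: contrapT => nUx; apply: nU; exists x.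
  by apply: dense_uc; [exact: uc_cst|exact: L2_cst].
pose d (x : pt) : R := inf [set `|x - y| | y in ~` U].
have hi x : has_inf [set `|x - y| | y in ~` U].
  by split; [exists `|x - y0|, y0|exists 0 => _ [y _ <-]].
have d0 x : 0 <= d x by apply: lb_le_inf; [case: (hi x)|move=> _ [y _ <-]].
have dl x y : d x <= d y + `|x - y|.
  rewrite -lerBlDr; apply: lb_le_inf; first by case: (hi y).
  move=> _ [z nUz <-]; rewrite lerBlDr.
  apply: (@le_trans _ _ `|x - z|).
    by apply: inf_lbound; [case: (hi x)|exists z].
  have -> : x - z = (x - y) + (y - z) by rewrite addrA subrK.
  by rewrite [leRHS]addrC; exact: ler_normD.
have dc : continuous d.
  move=> x; apply/cvgrPdist_lt => e e_gt0; near=> y.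
  have xy : `|x - y| < e by near: y; apply: cvgr_dist_lt => //; exact: cvg_id.
  apply: le_lt_trans xy; rewrite ler_norml; have := dl x y; have := dl y x.
  by rewrite (distrC y x) => ? ?; apply/andP; split; lra.
have dnU x : ~ U x -> d x = 0.
  move=> nUx; apply/eqP; rewrite eq_le d0 andbT; apply: inf_lbound; first by case: (hi x).
  by exists x => //; rewrite subrr normr0.
have dU x : U x -> 0 < d x.
  move=> Ux; have /nbhs_ballP[e /= e_gt0 he] : nbhs x U by exact: open_nbhs_nbhs.
  apply: lt_le_trans e_gt0 _; apply: lb_le_inf; first by case: (hi x).
  move=> _ [y nUy <-]; rewrite leNgt; apply/negP => h; apply: nUy; apply: he.
  by rewrite -ball_normE.
(* These tend to the indicator of U: the value at a point of U is 1 once n >= 1 / d x, and off U it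
   is always 0. *)
pose v_ n (x : pt) : R := Num.min 1 (n%:R * d x).
have vc n : continuous (v_ n).
  move=> x; apply: (@continuous_min _ _ (cst 1) (fun x => n%:R * d x)).
    exact: cvg_cst.
  by apply: cvgM; [exact: cvg_cst|exact: dc].
have v01 n x : 0 <= v_ n x <= 1.
  by rewrite /v_ le_min ler01 mulr_ge0 ?ler0n //= ge_min lexx.
have hv n : L2 (v_ n).
  apply: (@L2_bounded _ 1); first exact: continuous_measurable_plane.
  by move=> x; have /andP[? ?] := v01 n x; rewrite ger0_norm.
apply: (@dense_dominated _ v_ (cst 1)) => //.
- by apply: L2_indic; exact: open_measurable_plane.
- move=> n; apply: dense_uc => //; apply: continuous_uc.
  exact: continuous_subspaceT.
- exact: int1_cst.
- move=> n x; have /andP[? ?] := v01 n x; rewrite indicE /=.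
  by case: (x \in U) => /=; nra.
- move=> x; case: (pselect (U x)) => Ux; rewrite indicE; last first.
    rewrite memNset //; apply: cvg_near_cst; apply: nearW => n.
    by rewrite /v_ dnU // mulr0 min_r.
  rewrite mem_set //; apply: cvg_near_cst.
  have dx := dU x Ux.
  exists (Num.bound (d x)^-1) => // n /= hn; rewrite /v_ min_l //.
  have : (d x)^-1 <= n%:R.
    apply: le_trans (ltW (archi_boundP _)) _; first by rewrite invr_ge0 ltW.
    by rewrite ler_nat.
  by rewrite -(ler_pM2r dx) mulVf // gt_eqF.
Unshelve. all: by end_near.
Qed.

(** Dynkin induction from the open sets, which are stable under intersection: complements by
    linearity, disjoint unions as dominated limits of finite ones. *)
Lemma dense_indic (A : set pt) : measurable A -> dense (\1_A : pt -> R).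
Proof.
move=> mA; have gA : <<s @open pt >> A by rewrite -measurable_plane_open.
apply: (@dynkin_induction _ pt (@open pt) (fun A => dense (\1_A : pt -> R))
  measurable_plane_open) gA => //.
- by move=> U V oU oV; exact: openI.
- by apply: dense_open; exact: openT.
- by move=> U oU; exact: dense_open.
- move=> S mS dS; have -> : (\1_(~` S) : pt -> R) = (-1) *: \1_S + cst 1.
    apply/funext => x; rewrite linE !indicE in_setC /=.
    by case: (x \in S) => /=; ring.
  by apply: dense_lin => //; [exact: L2_indic|exact: L2_cst|
    apply: dense_uc; [exact: uc_cst|exact: L2_cst]].
- move=> F mF tF dF.
  have mN n : measurable (\big[setU/set0]_(k < n) F k) by exact: bigsetU_measurable.
  apply: (@dense_dominated _ (fun n => \1_(\big[setU/set0]_(k < n) F k)) (cst 1)).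
  + by apply: L2_indic; exact: bigcupT_measurable.
  + by move=> n; exact: L2_indic.
  + elim=> [|n IH].
      rewrite big_ord0 indic0; apply: dense_uc; [exact: uc_cst|exact: L2_cst].
    rewrite big_ord_recr /=.
    have -> : (\1_(\big[setU/set0]_(k < n) F k `|` F n) : pt -> R) =
        1 *: \1_(\big[setU/set0]_(k < n) F k) + \1_(F n).
      rewrite scale1r; apply/funext => x; rewrite /GRing.add /= !indicE in_setU.
      case: (boolP (x \in F n)) => h; last by rewrite orbF addr0.
      rewrite orbT memNset ?add0r // -bigcup_mkord => -[k /= kn Fkx].
      move: h; rewrite inE => Fnx.
      have := (trivIsetP.1 tF) k n I I; rewrite (ltn_eqF kn) => /(_ isT).
      by move/seteqP => [/(_ x) + _]; apply.
    by apply: dense_lin => //; exact: L2_indic.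
  + exact: int1_cst.
  + move=> n x; rewrite !indicE /=.
    by case: (x \in _); case: (x \in _) => /=; rewrite ?subrr ?subr0 ?sub0r ?sqrrN ?expr1n ?expr0n.
  + move=> x; rewrite indicE; case: (boolP (x \in \bigcup_k F k)) => h; last first.
      apply: cvg_near_cst; apply: nearW => n; rewrite indicE memNset // -bigcup_mkord.
      by move=> [k _ Fkx]; move/negP: h; apply; rewrite inE; exists k.
    move: h; rewrite inE => -[k _ Fkx]; apply: cvg_near_cst; exists k.+1 => // n /= kn.
    by rewrite indicE mem_set // -bigcup_mkord; exists k.
Qed.

Import HBNNSimple.

Lemma dense_simple (s : seq R) (A : R -> set pt) : (forall y, measurable (A y)) ->
  let u : pt -> R := fun x => \sum_(y <- s) y * \1_(A y) x in L2 u /\ dense u.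
Proof.
move=> mA u; rewrite {}/u; elim: s => [|y s [h1 h2]].
  under eq_fun do rewrite big_nil.
  by split; [exact: L2_cst|apply: dense_uc; [exact: uc_cst|exact: L2_cst]].
under eq_fun do rewrite big_cons.
have hi := L2_indic (mA y).
by split; [exact: (@L2_lin y _ _ hi h1)|exact: (@dense_lin y _ _ hi h1 (dense_indic (mA y)) h2)].
Qed.

Lemma dense_nonneg u : L2 u -> (forall x, 0 <= u x) -> dense u.
Proof.
move=> hu u0; have mu := L2_measurable hu.
have meu : measurable_fun setT (EFin \o u) by exact/measurable_EFinP.
have eu0 x : setT x -> (0 <= (EFin \o u) x)%E by rewrite /= lee_fin.
pose v_ n : pt -> R := nnsfun_approx measurableT meu n.
have sv n : L2 (v_ n) /\ dense (v_ n).
  pose A y : set pt := v_ n @^-1` [set y].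
  have mA y : measurable (A y) by exact: measurable_sfunP.
  have -> : v_ n = (fun x => \sum_(y <- finmap.enum_fset (fset_set (range (v_ n)))) y * \1_(A y) x).
    apply/funext => x; rewrite /A /v_ [LHS]fimfunE fsbig_finite //.
  exact: dense_simple.
have vu n x : v_ n x <= u x.
  by rewrite /v_ nnsfun_approxE -lee_fin; exact: (@le_approx _ _ _ setT (EFin \o u) n x).
have v0 n x : 0 <= v_ n x by rewrite /v_; exact: fun_ge0.
apply: (@dense_dominated u v_ (fun x => u x ^+ 2)) => //.
- by move=> n; have [] := sv n.
- by move=> n; have [] := sv n.
- exact: L2_sqr.
- by move=> n x; have := vu n x; have := v0 n x; nra.
- move=> x; have h := cvg_nnsfun_approx measurableT meu eu0 (I : setT x).
  exact: (fine_cvg h).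
Qed.

Lemma L2_norm u : L2 u -> L2 (fun x => `|u x|).
Proof.
move=> hu; apply/L2P; split.
  by apply: measurableT_comp => //; exact: L2_measurable.
rewrite (_ : (fun x => _) = (fun x => u x ^+ 2)); first exact: L2_sqr.
by apply/funext => x; rewrite real_normK ?num_real.
Qed.

Lemma dense_L2 u : L2 u -> dense u.
Proof.
move=> hu; have hn := L2_norm hu; have hd := L2_sub hn hu.
have dn : dense (fun x => `|u x|) by apply: dense_nonneg.
have dd : dense ((fun x => `|u x|) - u).
  by apply: dense_nonneg => // x; rewrite subE subr_ge0 ler_norm.
have -> : u = (-1) *: ((fun x => `|u x|) - u) + (fun x => `|u x|).
  apply/funext => x; rewrite linE.
  by rewrite (_ : ((fun x => `|u x|) - u) x = `|u x| - u x) //; ring.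
exact: dense_lin.
Qed.

End Density.

(** * Continuous versions of functions of bounded energy *)

Lemma avg_mul_small g phi (e : R) : L2 g -> L2 phi -> (forall w, avg (g \o wmap w) = 0) ->
  forall n, (forall w x y, size w = n -> K x -> K y ->
    `|phi (wmap w x) - phi (wmap w y)| <= e) ->
  `|avg (fun x => g x * phi x)| <= e * avg (fun x => `|g x|).
Proof.
move=> + + + n; elim: n g phi => [|n IH] g phi hg hp h0 he.
  pose c := phi (p i0).
  have ig := L2_int hg; have igp := L2_mul hg hp.
  have ing := L2_int (L2_norm hg).
  (* As g has mean zero, phi can be replaced by its deviation from a corner value, which is at most
     e. *)
  have -> : avg (fun x => g x * phi x) = avg ((- c) *: g + (fun x => g x * phi x)).
    by rewrite avgD // (h0 [::]) mulr0 add0r.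
  have il := int1_lin (- c) ig igp.
  have ir : int1 (e *: (fun x => `|g x|) + cst 0) by apply: int1_lin => //; exact: int1_cst.
  have ir' : int1 ((- e) *: (fun x => `|g x|) + cst 0) by apply: int1_lin => //; exact: int1_cst.
  have hb x : K x -> `|((- c) *: g + (fun x => g x * phi x)) x| <= e * `|g x|.
    move=> Kx; rewrite linE (_ : _ + _ = (phi x - c) * g x); last by ring.
    by rewrite normrM ler_wpM2r //; exact: (he [::] x (p i0) erefl Kx (K_pt i0)).
  have e1 : avg (e *: (fun x => `|g x|) + cst 0) = e * avg (fun x => `|g x|).
    by rewrite avgD ?avg_cst ?addr0 //; exact: int1_cst.
  have e2 : avg ((- e) *: (fun x => `|g x|) + cst 0) = - (e * avg (fun x => `|g x|)).
    by rewrite avgD ?avg_cst ?addr0 ?mulNr //; exact: int1_cst.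
  rewrite ler_norml -e2 -e1; apply/andP; split; apply: avg_le => // x /hb;
    by rewrite [X in _ -> X]/= !linE /= ler_norml => /andP[? ?]; lra.
have h i : `|avg (fun x => (g \o fm i) x * (phi \o fm i) x)| <=
    e * avg (fun x => `|(g \o fm i) x|).
  apply: IH; [exact: (L2_comp [:: i])|exact: (L2_comp [:: i])| |].
  - by move=> w; exact: (h0 (i :: w)).
  - by move=> w x y sw Kx Ky; apply: (he (i :: w)); rewrite //= sw.
rewrite (avgS (L2_mul hg hp)) (avgS (L2_int (L2_norm hg))) !sum3E.
have := h i0; have := h i1; have := h i2.
rewrite -![(fun x => g x * phi x) \o _]/(fun x => (g \o fm _) x * (phi \o fm _) x).
rewrite -![(fun x => `|g x|) \o _]/(fun x => `|(g \o fm _) x|).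
do 6 (move: (avg _) => ?).
by rewrite !ler_norml => /andP[? ?] /andP[? ?] /andP[? ?]; apply/andP; split; lra.
Qed.

Lemma avg_cells0_ae g : L2 g -> (forall w, avg (g \o wmap w) = 0) -> g = cst 0 %[ae nu].
Proof.
move=> hg h0.
have g2 : avg (fun x => g x ^+ 2) = 0.
  apply/eqP; rewrite eq_le avg_sqr_ge0 andbT; apply/ler_addgt0Pr => e e_gt0.
  rewrite add0r; have [phi [up hp hgp]] := dense_L2 hg e_gt0.
  (* By this orthogonality the integral of (g - phi)^2, which is at most e, dominates that of
     g^2. *)
  have gp0 : avg (fun x => g x * phi x) = 0.
    apply/eqP; rewrite -normr_le0; apply/ler_addgt0Pr => d d_gt0; rewrite add0r.
    pose M := avg (fun x => `|g x|).
    have M0 : 0 <= M by apply: Rintegral_ge0.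
    have dM : 0 < d / (M + 1) by rewrite divr_gt0 // ltr_wpDl.
    have [N hN] := up _ dM.
    apply: (@le_trans _ _ (d / (M + 1) * M)).
      apply: (@avg_mul_small g phi (d / (M + 1)) hg hp h0 N) => w x y sw Kx Ky.
      by apply/ltW/hN; rewrite ?sw.
    rewrite mulrAC ler_pdivrMr ?ltr_wpDl // ler_wpM2l ?ltW //; lra.
  apply: le_trans hgp.
  have i1 := L2_sqr hg; have i2 := L2_mul hg hp; have i3 := L2_sqr hp.
  have -> : (fun x => (g x - phi x) ^+ 2) =
      (-2) *: (fun x => g x * phi x) + (1 *: (fun x => g x ^+ 2) + (fun x => phi x ^+ 2)).
    by apply/funext => x; rewrite !linE; ring.
  rewrite avgD //; last exact: int1_lin.
  rewrite gp0 mulr0 add0r avgD // mul1r; have := avg_sqr_ge0 phi; lra.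
have mg := L2_measurable hg; have ig2 := L2_sqr hg.
have : (\int[nu]_x `|(EFin \o (fun x => (g x ^+ 2)%R)) x| = 0)%E.
  have -> : (\int[nu]_x `|(EFin \o (fun x => (g x ^+ 2)%R)) x| = \int[nu]_x (g x ^+ 2)%:E)%E.
    by apply: eq_integral => x _; rewrite /= ger0_norm ?sqr_ge0.
  have fi : (\int[nu]_x (g x ^+ 2)%:E \is a fin_num)%E by exact: integrable_fin_num.
  by rewrite -(fineK fi) (_ : fine _ = 0).
have m2 : measurable_fun setT (EFin \o (fun x => g x ^+ 2)).
  by apply/measurable_EFinP; exact: measurable_funX.
move=> /(ae_eq_integral_abs nu measurableT m2).1; apply: filterS => x /(_ I) /= -[/eqP].
by rewrite expf_eq0 /= => /eqP.
Qed.

Lemma nbr_rcons w i j : i != j -> nbr (rcons w i) (rcons w j).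
Proof. by move=> ij; elim: w => [|k w IH] /=; rewrite ?(negbTE ij) ?eqxx. Qed.

Lemma avg_children u w : int1 u ->
  avg (u \o wmap w) = 3^-1 * \sum_(i < 3) avg (u \o wmap (rcons w i)).
Proof.
move=> iu; rewrite avgS; last exact: integrable_comp.
congr (_ * _); apply: eq_bigr => i _; congr avg; apply/funext => x /=.
by rewrite wmap_rcons.
Qed.

Lemma continuous_version u M : L2 u -> (forall n, cell_energy u n.+1 <= M) ->
  exists h, [/\ uc h, L2 h, u = h %[ae nu] & forall n, cell_energy h n = cell_energy u n].
Proof.
move=> hu hM; have iu := L2_int hu.
have M0 : 0 <= M by apply: le_trans (hM 0%N); exact: cell_energy_ge0.
pose c w := avg (u \o wmap w); pose m := Num.sqrt M.
have m0 : 0 <= m by exact: sqrtr_ge0.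
have hn w w' : size w = size w' -> nbr w w' -> `|c w - c w'| <= m * r ^+ size w.
  (* A single term of the energy gives (c w - c w')^2 <= M (3/5)^n <= (m (4/5)^n)^2. Empty words
     have no neighbors, in accordance with a bound that starts at level 1. *)
  case: w w' => [|i w] [|j w'] // sw hww.
  rewrite -(@ler_pXn2r _ 2) ?nnegrE ?mulr_ge0 ?exprn_ge0 //; try lra.
  rewrite real_normK ?num_real // exprMn sqr_sqrtr // exprAC.
  have h1 : (c (i :: w) - c (j :: w')) ^+ 2 <= word_energy c (size (i :: w)).
    rewrite /word_energy (bigD1 (in_tuple (i :: w), tcast (esym sw) (in_tuple (j :: w')))) /=; last first.
      by rewrite val_tcast.
    by rewrite val_tcast /= lerDl; apply: sumr_ge0 => *; exact: sqr_ge0.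
  apply: le_trans h1 _; have := hM (size w); rewrite /cell_energy -/c.
  set D := word_energy c _; rewrite -[size (i :: w)]/(size w).+1 in D *.
  move: (size w).+1 => n in D *.
  have t0 : 0 < (5 / 3 : R) ^+ n by rewrite exprn_gt0 //; lra.
  rewrite mulrC -ler_pdivlMr // => /le_trans; apply; rewrite ler_wpM2l //.
  by rewrite -exprVn invf_div lerXn2r ?nnegrE //; lra.
have hc w i : `|c (rcons w i) - c w| <= m * r ^+ size w.
  have rn : 0 <= m * r ^+ size w by rewrite mulr_ge0 ?exprn_ge0 //; lra.
  have hr j k : `|c (rcons w j) - c (rcons w k)| <= m * r ^+ size w.
    case: (eqVneq j k) => [->|jk]; first by rewrite subrr normr0.
    apply: le_trans (hn _ _ _ (nbr_rcons w jk)) _; first by rewrite !size_rcons.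
    by rewrite size_rcons exprS; lra.
  rewrite [c w]/c (avg_children w iu) -/(c _) sum3E.
  have := hr i i0; have := hr i i1; have := hr i i2.
  rewrite /c !ler_norml => /andP[? ?] /andP[? ?] /andP[? ?].
  by apply/andP; split; lra.
have [h0 hh0] := extend_words m0 hc hn.
have uh0 := uc_of_words hh0.
have [uh hh] := uc_restrict uh0; set h := h0 \_ K in uh hh.
have hcw w x : K x -> `|h (wmap w x) - c w| <= 6 * m * r ^+ size w.
  by move=> Kx; rewrite /h restrict_K; [exact: hh0|exact: K_wmap].
have ih := L2_int hh.
have hg := L2_sub hu hh; have ig := L2_int hg.
have gE w : avg ((u - h) \o wmap w) = c w - avg (h \o wmap w).
  rewrite (_ : (u - h) \o wmap w = (-1) *: (h \o wmap w) + (u \o wmap w)); last first.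
    by apply/funext => x; rewrite linE /= subE; ring.
  by rewrite avgD; [rewrite mulN1r addrC|exact: integrable_comp|exact: integrable_comp].
(* The mean over a cell is the mean of those over its descendants k levels below, whose bounds tend
   to 0 with k. *)
have g0 w : avg ((u - h) \o wmap w) = 0.
  apply: (@r_eq0 _ (6 * m)) => k.
  have : `|avg ((u - h) \o wmap w)| <= 6 * m * r ^+ (size w + k).
    elim: k w => [|k IH] w.
      rewrite addn0 gE distrC; apply: avg_dist; first exact: integrable_comp.
      by move=> x Kx; exact: hcw.
    rewrite (avg_children w ig) sum3E.
    have := IH (rcons w i0); have := IH (rcons w i1); have := IH (rcons w i2).
    rewrite !size_rcons addSnnS !ler_norml => /andP[? ?] /andP[? ?] /andP[? ?].
    by apply/andP; split; lra.
  move/le_trans; apply; apply: ler_wpM2l; first lra.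
  by rewrite exprD -[leRHS]mul1r ler_wpM2r ?exprn_ge0 ?exprn_ile1 //; lra.
exists h; split => //.
  have := avg_cells0_ae hg g0; apply: filterS => x /(_ I) e _; apply/eqP.
  by rewrite -subr_eq0; apply/eqP.
move=> n; rewrite /cell_energy; congr (_ * word_energy _ _); apply/funext => w.
by have := g0 w; rewrite gE => /eqP; rewrite subr_eq0 => /eqP <-.
Qed.

(** * The limit of the vertex energies as a bilinear form *)

Lemma bounded_en_eq h k : {in K, h =1 k} -> bounded_en h -> bounded_en k.
Proof. by move=> hk [M hM]; exists M => n; rewrite -(eq_en n hk hk). Qed.

Lemma en_quad n a u v : en n (a *: u + v) (a *: u + v) =
  a ^+ 2 * en n u u + 2 * a * en n u v + en n v v.
Proof.
rewrite en_linear en_sym (en_sym n v) !en_linear (en_sym n v u); ring.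
Qed.

Lemma en_lin_le n a u v : en n (a *: u + v) (a *: u + v) <=
  2 * a ^+ 2 * en n u u + 2 * en n v v.
Proof.
have := en_ge0 n ((- a) *: u + v); rewrite !en_quad sqrrN.
lra.
Qed.

Lemma bounded_en_lin a u v : bounded_en u -> bounded_en v -> bounded_en (a *: u + v).
Proof.
move=> bu bv; exists (2 * a ^+ 2 * limit_energy u + 2 * limit_energy v) => n.
apply: le_trans (en_lin_le _ _ _ _) _; apply: lerD.
  by apply: ler_wpM2l; [rewrite mulr_ge0 ?sqr_ge0|exact: en_le_limit].
by rewrite ler_wpM2l //; exact: en_le_limit.
Qed.

Lemma en_cst c n : en n (cst c) (cst c) = 0.
Proof.
elim: n => [|n IH] /=; last by rewrite big1 ?mulr0 // => i _; exact: IH.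
by rewrite /e0 big1 // => i _; rewrite big1 // => j _; rewrite /= subrr mul0r.
Qed.

Lemma bounded_en_cst c : bounded_en (cst c).
Proof. by exists 0 => n; rewrite en_cst. Qed.

Definition limit_form u v : R := limn (fun n => en n u v).

(** Polarization, since monotonicity in the level is available only on the diagonal. *)
Lemma cvg_limit_form u v : bounded_en u -> bounded_en v ->
  (fun n => en n u v) @ \oo --> limit_form u v.
Proof.
move=> bu bv.
suff : cvgn (fun n => en n u v) by [].
have -> : (fun n => en n u v) = (fun n => 4^-1 *
    (en n (1 *: u + v) (1 *: u + v) - en n ((-1) *: u + v) ((-1) *: u + v))).
  by apply/funext => n; rewrite !en_quad; field.
apply/cvg_ex; eexists; apply: cvgM; first exact: cvg_cst.
by apply: cvgB; apply: cvg_en; exact: bounded_en_lin.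
Qed.

Lemma limit_form_lin a u v w : bounded_en u -> bounded_en v -> bounded_en w ->
  limit_form (a *: u + v) w = a * limit_form u w + limit_form v w.
Proof.
move=> bu bv bw; apply: cvg_lim => //; under eq_fun do rewrite en_linear.
apply: cvgD; last exact: cvg_limit_form.
by apply: cvgM; [exact: cvg_cst|exact: cvg_limit_form].
Qed.

Lemma limit_form_eq u u' v v' : {in K, u =1 u'} -> {in K, v =1 v'} -> limit_form u v = limit_form u' v'.
Proof. by move=> hu hv; congr (limn _); apply/funext => n; exact: eq_en. Qed.

(** The energy of level k sees finitely many points, so energy bounds uniform in k survive pointwise
    limits. *)
Lemma cvg_en_pointwise k (u_ : nat -> pt -> R) u :
  (forall x, K x -> (fun n => u_ n x) @ \oo --> u x) ->
  (fun n => en k (u_ n) (u_ n)) @ \oo --> en k u u.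
Proof.
elim: k u_ u => [|k IH] u_ u h /=; last first.
  rewrite sum3E; under eq_fun do rewrite sum3E.
  have h' i : (fun n => en k (u_ n \o fm i) (u_ n \o fm i)) @ \oo -->
      en k (u \o fm i) (u \o fm i).
    by apply: IH => x Kx; apply: h; exact: K_map.
  by apply: cvgM; [exact: cvg_cst|apply: cvgD; [apply: cvgD|]].
rewrite /e0 !sum3E; under eq_fun do rewrite !sum3E.
have hd i j : (fun n => ((u_ n \o p) i - (u_ n \o p) j) * ((u_ n \o p) i - (u_ n \o p) j))
    @ \oo --> ((u \o p) i - (u \o p) j) * ((u \o p) i - (u \o p) j).
  by apply: cvgM; apply: cvgB; apply: h; exact: K_pt.
by apply: cvgD; [apply: cvgD|]; apply: cvgD; try apply: cvgD.
Qed.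

Lemma ae_comp w (u v : pt -> R) : u = v %[ae nu] -> (u \o wmap w) = (v \o wmap w) %[ae nu].
Proof.
elim: w u v => [|i w IH] u v h //; apply: (IH (u \o fm i) (v \o fm i)).
have : {ae nu, forall x, u x = v x} by apply: filterS h => x; exact.
by move/(ae_preimage i); apply: filterS => x.
Qed.

Lemma cell_energy_ae u v n : L2 u -> L2 v -> u = v %[ae nu] -> cell_energy u n = cell_energy v n.
Proof.
move=> hu hv h; rewrite /cell_energy; congr (_ * word_energy _ _); apply/funext => w.
by apply: avg_ae; [exact: L2_measurable (L2_comp w hu)|
  exact: L2_measurable (L2_comp w hv)|exact: ae_comp].
Qed.

Lemma ae_sym (u v : pt -> R) : u = v %[ae nu] -> v = u %[ae nu].
Proof. by apply: filterS => x h /h. Qed.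

Lemma ae_trans (u v w : pt -> R) : u = v %[ae nu] -> v = w %[ae nu] -> u = w %[ae nu].
Proof. by apply: filterS2 => x h1 h2 Tx; rewrite h1 ?h2. Qed.

Lemma ae_lin a (u v u' v' : pt -> R) : u = u' %[ae nu] -> v = v' %[ae nu] ->
  a *: u + v = a *: u' + v' %[ae nu].
Proof. by apply: filterS2 => x h1 h2 Tx; rewrite !linE h1 ?h2. Qed.

(** * The Dirichlet form *)

Definition dom : set (pt -> R) := [set u | L2 u /\ (sup_energy K nu u < +oo)%E].

Lemma sup_energy_le u (M : R) : L2 u -> (forall n, cell_energy u n.+1 <= M) ->
  (sup_energy K nu u <= M%:E)%E.
Proof.
move=> hu h; apply: ge_ereal_sup => _ [[|n] /= n1 <-] //.
by rewrite avg_energyE ?lee_fin //; exact: L2_int.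
Qed.

Lemma le_sup_energy u n : L2 u -> ((cell_energy u n.+1)%:E <= sup_energy K nu u)%E.
Proof.
move=> hu; rewrite -avg_energyE; last exact: L2_int.
by apply: ereal_sup_ubound; exists n.+1.
Qed.

Lemma domP u : dom u <-> L2 u /\ exists M, forall n, cell_energy u n.+1 <= M.
Proof.
split=> [[hu sf]|[hu [M hM]]]; last first.
  by split => //; apply: le_lt_trans (sup_energy_le hu hM) _; exact: ltry.
split => //; exists (fine (sup_energy K nu u)) => n.
rewrite -lee_fin fineK; first exact: le_sup_energy.
rewrite fin_real // sf andbT; apply: lt_le_trans (le_sup_energy 0 hu).
exact: ltNyr.
Qed.

Lemma sup_energy_fin u : dom u -> exists2 M, sup_energy K nu u = M%:E &
  forall n, cell_energy u n.+1 <= M.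
Proof.
move=> [hu sf]; have fi : sup_energy K nu u \is a fin_num.
  by rewrite fin_real // sf andbT; apply: lt_le_trans (le_sup_energy 0 hu); exact: ltNyr.
exists (fine (sup_energy K nu u)); first by rewrite fineK.
by move=> n; rewrite -lee_fin fineK //; exact: le_sup_energy.
Qed.

Definition version u h := [/\ uc h, L2 h & u = h %[ae nu]].

(** Any choice serves, as two versions agree on K by [eq_ae_uc_K]. The default value [u] never
    occurs on [dom]. *)
Definition rep (u : pt -> R) : pt -> R :=
  if pselect (exists h, version u h) is left e then projT1 (cid e) else u.

Lemma repP u : dom u -> version u (rep u).
Proof.
move=> /domP[hu [M hM]]; rewrite /rep; case: pselect => [e|ne].
  by case: (cid e).
exfalso; apply: ne; have [h [uh hh e _]] := continuous_version hu hM.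
by exists h.
Qed.

Lemma rep_bounded_le u (M : R) : dom u -> (forall n, cell_energy u n.+1 <= M) ->
  forall n, en n (rep u) (rep u) <= 240 * M.
Proof.
move=> du hM; have [uh hh e] := repP du; have [hu _] := du.
apply: en_le_cell_energy => //; first exact: L2_int.
by move=> n; rewrite -(cell_energy_ae n.+1 hu hh e).
Qed.

Lemma rep_bounded u : dom u -> bounded_en (rep u).
Proof.
move=> du; have /domP[_ [M hM]] := du.
by exists (240 * M); exact: rep_bounded_le.
Qed.

Lemma dom_of_version u h : L2 u -> version u h -> bounded_en h -> dom u.
Proof.
move=> hu [uh hh e] bh; apply/domP; split => //; exists (1200 * limit_energy h) => n.
by rewrite (cell_energy_ae n.+1 hu hh e); apply: cell_energy_le => //; exact: L2_int.
Qed.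

Lemma dom_uc h : uc h -> bounded_en h -> dom (h \_ K).
Proof.
move=> uh bh; have [ur hr] := uc_restrict uh.
apply: (@dom_of_version _ (h \_ K)) => //.
- by split => //; apply: aeW.
- by apply: bounded_en_eq bh => x; rewrite inE => Kx; rewrite restrict_K.
Qed.

Lemma version_rep u h : dom u -> uc h -> u = h %[ae nu] -> {in K, rep u =1 h}.
Proof.
move=> du uh e; have [ur _ er] := repP du; apply: eq_ae_uc_K => //.
by apply: ae_trans e; exact: ae_sym.
Qed.

Definition form (u v : pt -> R) : R := limit_form (rep u) (rep v).

Lemma formE u v h k : dom u -> dom v -> uc h -> uc k -> u = h %[ae nu] -> v = k %[ae nu] ->
  form u v = limit_form h k.
Proof. by move=> du dv uh uk eu ev; apply: limit_form_eq; exact: version_rep. Qed.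

Lemma form_le u h (M : R) : dom u -> uc h -> u = h %[ae nu] ->
  (forall n, en n h h <= M) -> form u u <= M.
Proof. by move=> du uh e hM; rewrite (formE du du uh uh e e); exact: limit_energy_le. Qed.

Lemma dom_lin a u v : dom u -> dom v -> dom (a *: u + v).
Proof.
move=> du dv; have [uu hu eu] := repP du; have [uv hv ev] := repP dv.
apply: (@dom_of_version _ (a *: rep u + rep v)).
- by apply: L2_lin; [case: du|case: dv].
- by split; [exact: uc_lin|exact: L2_lin|exact: ae_lin].
- by apply: bounded_en_lin; exact: rep_bounded.
Qed.

Lemma dom_sub u v : dom u -> dom v -> dom (u - v).
Proof. by move=> du dv; rewrite addrC -scaleN1r; exact: dom_lin. Qed.

Lemma dom_ae u v : dom u -> L2 v -> u = v %[ae nu] -> dom v.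
Proof.
move=> du hv e; have [uh hh eh] := repP du.
apply: (@dom_of_version _ (rep u)) => //; last exact: rep_bounded.
by split => //; apply: ae_trans eh; exact: ae_sym.
Qed.

Lemma form_domain_dom : form_domain nu dom.
Proof.
split.
- by move=> u [].
- by move=> u v; exact: dom_ae.
- apply: (@dom_of_version _ (cst 0)); first exact: L2_cst.
    by split; [exact: uc_cst|exact: L2_cst|exact: aeW].
  exact: bounded_en_cst.
- by move=> a u v; exact: dom_lin.
Qed.

Lemma spline_dom g e : uc g -> 0 < e -> exists v, [/\ dom v, uc v &
  forall x, K x -> `|g x - v x| < e].
Proof.
move=> ug e_gt0; have e3 : 0 < e / 3 by rewrite divr_gt0.
have [N hN] := ug _ e3.
have [h uh hh] := spline_extend N g.
exists (h \_ K); split.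
- by apply: dom_uc => //; exact: spline_bounded_en hh.
- by have [] := uc_restrict uh.
- move=> x Kx; rewrite restrict_K // distrC.
  apply: le_lt_trans (@spline_approx N g h (e / 3) uh hh _ x Kx) _; last lra.
  by move=> w x' y sw Kx' Ky; apply/ltW/hN; rewrite ?sw.
Qed.

Lemma avg_sqr_le u e : L2 u -> (forall x, K x -> `|u x| <= e) -> avg (fun x => u x ^+ 2) <= e ^+ 2.
Proof.
move=> hu h; rewrite -(avg_cst (e ^+ 2)); apply: avg_le; first exact: L2_sqr.
  exact: int1_cst.
move=> x /h hx; rewrite /= -real_normK ?num_real // lerXn2r ?nnegrE //.
exact: le_trans hx.
Qed.

Lemma L2norm_lt u (e : R) : L2 u -> 0 < e -> avg (fun x => u x ^+ 2) < e ^+ 2 ->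
  L2norm nu u < e.
Proof.
move=> hu e_gt0; by rewrite -L2norm_sqr // ltr_pXn2r ?nnegrE ?L2norm_ge0 ?ltW.
Qed.

Lemma form_densely_defined : densely_defined nu dom.
Proof.
move=> u hu e e_gt0.
have e4 : 0 < e ^+ 2 / 8 by rewrite divr_gt0 // exprn_gt0.
have e8 : 0 < e / 4 by rewrite divr_gt0.
have [g [ug hg hug]] := dense_L2 hu e4.
have [v [dv uv hv]] := spline_dom ug e8.
have hv2 : L2 v by case: dv.
exists v => //; apply: L2norm_lt => //; first exact: L2_sub.
apply: (@le_lt_trans _ _ (2 * avg (fun x => (u x - g x) ^+ 2) +
   2 * avg (fun x => (g x - v x) ^+ 2))); first exact: avg_sqr_split.
have : avg (fun x => (g x - v x) ^+ 2) <= (e / 4) ^+ 2.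
  by apply: (@avg_sqr_le (g - v)); [exact: L2_sub|move=> x /hv /ltW].
have : 0 < e ^+ 2 by rewrite exprn_gt0.
by rewrite expr_div_n; lra.
Qed.

Lemma avg_sqr_Jensen u : L2 u -> avg u ^+ 2 <= avg (fun x => u x ^+ 2).
Proof.
move=> hu; have := avg_sqr_ge0 (u - cst (avg u)).
have iu := L2_int hu; have i2 := L2_sqr hu; have ic := int1_cst (avg u ^+ 2).
have -> : (fun x => (u - cst (avg u)) x ^+ 2) =
    (- 2 * avg u) *: u + (1 *: (fun x => u x ^+ 2) + cst (avg u ^+ 2)).
  by apply/funext => x; rewrite !linE subE /=; ring.
rewrite avgD // ?avgD //; last exact: int1_lin.
by rewrite avg_cst; lra.
Qed.

(** The form norm controls the sup norm on K: 21 is 1 for the mean, by Jensen, plus 20 for the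
    oscillation. *)
Lemma sup_norm_le h (e : R) : uc h -> L2 h -> 0 <= e -> (forall n, en n h h <= e ^+ 2) ->
  avg (fun x => h x ^+ 2) <= e ^+ 2 -> forall x, K x -> `|h x| <= 21 * e.
Proof.
move=> uh hh e0 he ha x Kx.
have h1 : `|avg h| <= e.
  rewrite -(@ler_pXn2r _ 2) ?nnegrE // real_normK ?num_real //.
  exact: le_trans (avg_sqr_Jensen hh) ha.
have h2 : `|avg h - h x| <= 20 * e.
  apply: avg_dist; first exact: L2_int.
  by move=> y Ky; exact: (osc_en2 uh e0 he).
move: h1 h2; rewrite !ler_norml => /andP[? ?] /andP[? ?]; apply/andP; split; lra.
Qed.

Lemma form_norm_sqr u : dom u ->
  form_norm nu form u ^+ 2 = limit_energy (rep u) + avg (fun x => u x ^+ 2).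
Proof.
move=> du; have [hu _] := du; rewrite /form_norm sqr_sqrtr ?L2norm_sqr //.
by rewrite addr_ge0 ?avg_sqr_ge0 //; exact: (limit_energy_ge0 (rep_bounded du)).
Qed.

Lemma form_norm_ge0 u : 0 <= form_norm nu form u.
Proof. exact: sqrtr_ge0. Qed.

(** The constant comes from 1 + 21^2 <= 22^2. *)
Lemma form_norm_le u h (e : R) : dom u -> version u h -> 0 <= e ->
  (forall n, en n h h <= e ^+ 2) -> (forall x, K x -> `|h x| <= 21 * e) ->
  form_norm nu form u <= 22 * e.
Proof.
move=> du [uh hh eh] e0 he hx; have [hu _] := du.
rewrite -(@ler_pXn2r _ 2) ?nnegrE ?form_norm_ge0 ?mulr_ge0 //.
rewrite form_norm_sqr //.
have h1 : limit_energy (rep u) <= e ^+ 2 := form_le du uh eh he.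
have h2 : avg (fun x => u x ^+ 2) <= (21 * e) ^+ 2.
  rewrite (@avg_ae _ (fun x => h x ^+ 2)); first exact: avg_sqr_le.
  - by apply: measurable_funX; exact: L2_measurable.
  - by apply: measurable_funX; exact: L2_measurable.
  - by apply: filterS eh => x h0 /h0 ->.
have := sqr_ge0 e; rewrite !exprMn; move: h1 h2; rewrite exprMn; lra.
Qed.

Lemma form_closed_dom : closed_form nu form dom.
Proof.
move=> u_ du hC.
pose h_ n := rep (u_ n).
have vh n : version (u_ n) (h_ n) by exact: repP.
have bh n : bounded_en (h_ n) by exact: rep_bounded.
pose d m n : pt -> R := (-1) *: h_ n + h_ m.
have dsub m n : u_ m - u_ n = (-1) *: u_ n + u_ m by rewrite scaleN1r addrC.
have ud m n : uc (d m n) by apply: uc_lin; [case: (vh n)|case: (vh m)].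
have hd m n : L2 (d m n) by apply: L2_lin; [case: (vh n)|case: (vh m)].
have ed m n : u_ m - u_ n = d m n %[ae nu].
  by rewrite dsub; apply: ae_lin; [case: (vh n)|case: (vh m)].
have ddom m n : dom (u_ m - u_ n) by exact: dom_sub.
have dE m n : limit_energy (rep (u_ m - u_ n)) = limit_energy (d m n).
  exact: (formE (ddom m n) (ddom m n) (ud m n) (ud m n) (ed m n) (ed m n)).
have bd m n : bounded_en (d m n) by exact: bounded_en_lin.
(* The Cauchy condition is split into a bound on all vertex energies and a sup norm bound on K, both
   of which pass to pointwise limits. *)
have hN (e : R) : 0 < e -> exists N, forall m n, (N <= m)%N -> (N <= n)%N ->
    (forall k, en k (d m n) (d m n) <= e ^+ 2) /\ (forall x, K x -> `|h_ m x - h_ n x| <= 21 * e).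
  move=> e_gt0; have [N hN] := hC e e_gt0; exists N => m n Nm Nn.
  have := hN m n Nm Nn; rewrite -(@ltr_pXn2r _ 2) ?nnegrE ?form_norm_ge0 ?ltW //.
  rewrite form_norm_sqr // dE.
  rewrite (@avg_ae _ (fun x => d m n x ^+ 2)); first last.
  - by apply: filterS (ed m n) => x h0 /h0 ->.
  - by apply: measurable_funX; exact: L2_measurable (hd m n).
  - by apply: measurable_funX; apply: L2_measurable; case: (ddom m n).
  move=> hlt; have q0 := limit_energy_ge0 (bd m n); have a0 := avg_sqr_ge0 (d m n).
  have hq k : en k (d m n) (d m n) <= e ^+ 2.
    apply: le_trans (en_le_limit k (bd m n)) _; apply: ltW; apply: le_lt_trans hlt.
    by rewrite lerDl.
  split => // x Kx.
  have -> : h_ m x - h_ n x = d m n x by rewrite /d linE; ring.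
  apply: sup_norm_le => //; first exact: ltW.
  by apply: ltW; apply: le_lt_trans hlt; rewrite lerDr.
(* Convergence is known on K only, which is why the limit is finally extended by zero. *)
pose h x : R := limn (fun n => h_ n x).
have hcv x : K x -> (fun n => h_ n x) @ \oo --> h x.
  move=> Kx; suff : cvgn (fun n => h_ n x) by [].
  apply/cauchy_cvgP/cauchy_ballP => e e_gt0.
  have e2 : 0 < e / 22 by rewrite divr_gt0.
  have [N hNe] := hN _ e2.
  pose S : set R := [set h_ n x | n in [set n | (N <= n)%N]].
  exists (S, S) => /=; first by split; exists N => // n Nn; exists n.
  move=> [s t] [/= [m Nm <-] [n Nn <-]]; rewrite /ball /=.
  by have [_ /(_ x Kx)] := hNe m n Nm Nn; lra.
have hh (e : R) : 0 < e -> exists N, forall n, (N <= n)%N ->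
    (forall k, en k ((-1) *: h + h_ n) ((-1) *: h + h_ n) <= e ^+ 2) /\
    (forall x, K x -> `|((-1) *: h + h_ n) x| <= 21 * e).
  move=> e_gt0; have [N hNe] := hN e e_gt0; exists N => n Nn; split => [k|x Kx].
    (* The level k stays fixed while m tends to infinity; this is the lower semicontinuity of the
       limit energy. *)
    have hc := @cvg_en_pointwise k (fun m => d n m) ((-1) *: h + h_ n) _.
    rewrite -(cvg_lim _ (hc _)) //; last first.
      move=> x Kx; rewrite /d; apply: cvgD; last exact: cvg_cst.
      by apply: cvgM; [exact: cvg_cst|exact: hcv].
    apply: limr_le.
      apply/cvg_ex; eexists; apply: hc => x Kx; rewrite /d; apply: cvgD; last exact: cvg_cst.
      by apply: cvgM; [exact: cvg_cst|exact: hcv].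
    by exists N => // m /= Nm; have [/(_ k)] := hNe n m Nn Nm.
  have hc : (fun m => `|h_ n x - h_ m x|) @ \oo --> `|h_ n x - h x|.
    by apply: cvg_norm; apply: cvgB; [exact: cvg_cst|exact: hcv].
  rewrite linE (_ : -1 * h x + h_ n x = h_ n x - h x); last by ring.
  rewrite -(cvg_lim _ hc) //; apply: limr_le; first by apply/cvg_ex; eexists; exact: hc.
  by exists N => // m /= Nm; have [_ /(_ x Kx)] := hNe n m Nn Nm.
have uh : uc h.
  move=> e e_gt0; have e1 : 0 < e / 100 by rewrite divr_gt0.
  have [N hNe] := hh _ e1; have [_ hx] := hNe N (leqnn N).
  have e3 : 0 < e / 3 by rewrite divr_gt0.
  have [uhN _ _] := vh N; have [N' hN'] := uhN _ e3.
  exists N' => w x y Nw Kx Ky; have := hN' w x y Nw Kx Ky.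
  have := hx _ (K_wmap w Kx); have := hx _ (K_wmap w Ky); rewrite !linE.
  rewrite !ler_norml !ltr_norml => /andP[? ?] /andP[? ?] /andP[? ?].
  by apply/andP; split; lra.
have bhh : bounded_en h.
  have [N hNe] := hh 1 ltr01; have [h1 _] := hNe N (leqnn N).
  have -> : h = (-1) *: ((-1) *: h + h_ N) + h_ N.
    by apply/funext => x; rewrite !linE; ring.
  by apply: bounded_en_lin => //; exists (1 ^+ 2).
have [ur hr] := uc_restrict uh.
have dr : dom (h \_ K) by exact: dom_uc.
exists (h \_ K) => //.
apply/cvgrPdist_le => e e_gt0; have e1 : 0 < e / 22 by rewrite divr_gt0.
have [N hNe] := hh _ e1; exists N => // n /= Nn.
rewrite sub0r normrN ger0_norm ?form_norm_ge0 //.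
have [h1 h2] := hNe n Nn.
have eK : {in K, (-1) *: h + h_ n =1 (-1) *: (h \_ K) + h_ n}.
  by move=> x; rewrite inE => Kx; rewrite !linE restrict_K.
have -> : e = 22 * (e / 22) by field.
apply: (@form_norm_le _ ((-1) *: (h \_ K) + h_ n)).
- exact: dom_sub.
- have [un hn en'] := vh n; split; [exact: uc_lin|exact: L2_lin|].
  have -> : u_ n - h \_ K = (-1) *: (h \_ K) + u_ n by rewrite scaleN1r addrC.
  by apply: ae_lin => //; exact: aeW.
- exact: ltW.
- by move=> k; rewrite -(eq_en k eK eK).
- by move=> x Kx; rewrite -eK ?inE //; exact: h2.
Qed.

Lemma clip_contract (s t : R) :
  `|Num.min (Num.max 0 s) 1 - Num.min (Num.max 0 t) 1| <= `|s - t|.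
Proof.
have hc (z : R) : [\/ z <= 0 /\ Num.min (Num.max 0 z) 1 = 0,
    0 <= z <= 1 /\ Num.min (Num.max 0 z) 1 = z | 1 <= z /\ Num.min (Num.max 0 z) 1 = 1].
  have [z0|z0] := leP z 0; first by constructor 1; rewrite min_l.
  have [z1|z1] := leP z 1; first by constructor 2; rewrite ltW.
  by constructor 3; rewrite ltW.
have := ler_norm (s - t); have := ler_norm (t - s); rewrite (distrC t s).
case: (hc s) => -[hs ->]; case: (hc t) => -[ht ->] => h1 h2;
  rewrite ler_norml; apply/andP; split; move: hs ht => /= hs ht;
  repeat match goal with H : is_true (_ && _) |- _ => case/andP: H => ? ? end; lra.
Qed.

Lemma form_markovian_dom : markovian form dom.
Proof.
move=> u du; pose phi (t : R) : R := Num.min (Num.max 0 t) 1.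
have [uh hh eh] := repP du; have bh := rep_bounded du.
have phi_meas (v : pt -> R) : measurable_fun setT v -> measurable_fun setT (phi \o v).
  move=> mv; rewrite (_ : phi \o v = (cst 0 \max v) \min cst 1) //.
  by apply: measurable_minr => //; exact: measurable_maxr.
have phi01 t : `|phi t| <= 1.
  by rewrite ger0_norm ?ge_min ?lexx ?orbT // le_min ler01 le_max lexx.
have hu : L2 u by case: du.
have hv : L2 (phi \o u).
  exact (L2_bounded (phi_meas u (L2_measurable hu)) (fun x => phi01 (u x))).
have ver : version (phi \o u) (phi \o rep u).
  split.
  - move=> e e_gt0; have [N hN] := uh e e_gt0; exists N => w x y Nw Kx Ky.
    by apply: le_lt_trans (clip_contract _ _) _; exact: hN.
  - exact (L2_bounded (phi_meas _ (L2_measurable hh)) (fun x => phi01 (rep u x))).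
  - by apply: filterS eh => x h0 /h0 /= ->.
have hle n : en n (phi \o rep u) (phi \o rep u) <= limit_energy (rep u).
  by apply: le_trans (en_le_limit n bh); apply: en_contract; exact: clip_contract.
have dv : dom (phi \o u) by apply: dom_of_version hv ver _; exists (limit_energy (rep u)).
split => //; have [uv _ ev] := ver.
exact: (form_le dv uv ev hle).
Qed.

Lemma form_dirichlet : dirichlet_form nu form dom.
Proof.
split.
- exact: form_domain_dom.
- exact: form_densely_defined.
- move=> u u' v du du' dv e; have [uh hh eh] := repP du; have [uv _ ev] := repP dv.
  rewrite (formE du' dv uh uv _ ev) //.
  by apply: ae_trans eh; exact: ae_sym.
- move=> a u v w du dv dw.
  have [uu hu eu] := repP du; have [uv hv ev] := repP dv; have [uw hw ew] := repP dw.
  rewrite (@formE _ _ (a *: rep u + rep v) (rep w)) //; last exact: ae_lin.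
  + by rewrite limit_form_lin //; exact: rep_bounded.
  + exact: dom_lin.
  + exact: uc_lin.
- by move=> u v du dv; congr (limn _); apply/funext => n; exact: en_sym.
- by move=> u du; apply: limit_energy_ge0; exact: rep_bounded.
- exact: form_closed_dom.
- exact: form_markovian_dom.
Qed.

Lemma form_regular : regular_form K nu form dom.
Proof.
split => [u du e e_gt0|g cg e e_gt0]; last first.
  have [v [dv uv hv]] := spline_dom (continuous_uc cg) e_gt0.
  by exists v; split => //; exact: uc_continuous.
have [uh hh eh] := repP du; have hu : L2 u by case: du.
have dr : dom (rep u) by exact: dom_ae eh.
(* The continuous version lies at form distance 0 from u, because the zero function is a version of
   the difference. *)
exists (rep u); split => //; first exact: uc_continuous.
apply: (@le_lt_trans _ _ (22 * 0)); last by rewrite mulr0.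
apply: (@form_norm_le _ (cst 0)) => //.
- exact: dom_sub.
- split; [exact: uc_cst|exact: L2_cst|].
  by apply: filterS eh => x h0 /h0 e'; rewrite subE e' subrr.
- by move=> n; rewrite en_cst expr0n.
- by move=> x _; rewrite normr0 mulr0.
Qed.

Lemma form_self_similar : self_similar form dom.
Proof.
move=> u du; have [uh hh eh] := repP du; have hu : L2 u by case: du.
have bh := rep_bounded du.
have ver i : version (u \o fm i) (rep u \o fm i).
  by split; [exact: uc_sub|exact: (L2_comp [:: i])|exact: (ae_comp [:: i])].
have dui i : dom (u \o fm i).
  apply: dom_of_version (ver i) _; first exact: (L2_comp [:: i]).
  exact: bounded_en_sub.
split => //; rewrite (_ : form u u = limit_energy (rep u)) // limit_energyS //; congr (_ * _).
apply: eq_bigr => i _; have [ui _ ei] := ver i.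
by rewrite (formE (dui i) (dui i) ui ui ei ei).
Qed.

Lemma en_eq0 n h k : (forall w, size w = n ->
    (forall j, h (wmap w (p j)) = 0) \/ (exists c, forall j, k (wmap w (p j)) = c)) ->
  en n h k = 0.
Proof.
elim: n h k => [|n IH] h k hw /=.
  rewrite /e0 big1 // => i _; rewrite big1 // => j _ /=.
  by have [h0|[c hc]] := hw [::] erefl; rewrite ?h0 ?hc !subrr ?mul0r ?mulr0.
by rewrite big1 ?mulr0 // => i _; apply: IH => w sw; apply: (hw (i :: w)); rewrite /= sw.
Qed.

Lemma form_strongly_local : strongly_local K nu form dom.
Proof.
move=> u v du dv cu _ [U [c [oU sU vc]]].
have [uu hu eu] := repP du; have [uv hv ev] := repP dv.
have u0 x : K x -> ~ ae_support K nu u x -> rep u x = 0.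
  move=> Kx nsx.
  have [W [oW Wx hW]] : exists W : set pt, [/\ open W, W x &
      {ae nu, forall y, (W `&` K) y -> u y = 0}].
    apply: contrapT => nW; apply: nsx; split => // W oW Wx hW; apply: nW.
    by exists W.
  apply: (@eq_ae_uc (rep u) (cst 0) W) => //; first exact: uc_cst.
  by apply: filterS2 hW eu => y h1 h2 hy; rewrite -h2 // h1.
have vU x : U x -> K x -> rep v x = c.
  move=> Ux Kx; apply: (@eq_ae_uc (rep v) (cst c) U) => //; first exact: uc_cst.
  by apply: filterS2 vc ev => y h1 h2 hy; rewrite -h2 // h1.
have [|N hN] := @small_cells (ae_support K nu u) (fun A => A `<=` U) cu.
  move=> x /sU Ux; have /nbhs_ballP[d /= d0 hd] : nbhs x U by exact: open_nbhs_nbhs.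
  by exists d => // A hA; exact: subset_trans hd.
rewrite /form /limit_form; apply: cvg_lim => //; apply: cvg_near_cst.
(* From level N on, a cell that meets the support of u lies in U, where v is constant; on the other
   cells u vanishes at the corners. So the vertex energies are exactly 0. *)
exists N => // n /= Nn; apply: en_eq0 => w sw.
case: (pselect (ae_support K nu u `&` wmap w @` K !=set0)) => hs.
  right; exists c => j; apply: vU; last by apply: K_wmap; exact: K_pt.
  by apply: (hN w _ hs); [rewrite sw|exists (p j) => //; exact: K_pt].
left => j; apply: u0; first by apply: K_wmap; exact: K_pt.
by move=> hj; apply: hs; exists (wmap w (p j)); split => //; exists (p j) => //; exact: K_pt.
Qed.

Lemma form_sup_energy u : dom u ->
  ((form u u)%:E <= 240%:E * sup_energy K nu u)%E /\
  (sup_energy K nu u <= 1200%:E * (form u u)%:E)%E.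
Proof.
move=> du; have [M sM hM] := sup_energy_fin du.
have [uh hh eh] := repP du; have hu : L2 u by case: du.
split.
  by rewrite sM -EFinM lee_fin; apply: limit_energy_le => n; exact: rep_bounded_le.
rewrite -EFinM; apply: sup_energy_le => // n.
rewrite (cell_energy_ae n.+1 hu hh eh); apply: cell_energy_le => //; first exact: L2_int.
exact: rep_bounded.
Qed.

End Measure.
End K.
End Geometry.

Theorem theorem2p1 (R : realType) (K : set (R * R))
    (nu : probability (R * R)%type R) :
  is_gasket K ->
  normalized_hausdorff (gasket_dim R) K nu ->
  exists (E : (R * R -> R) -> (R * R -> R) -> R) (F : set (R * R -> R)),
    dirichlet_form nu E F /\
    regular_form K nu E F /\
    strongly_local K nu E F /\
    self_similar E F /\
    F = [set u | u \in Lfun nu 2%:E /\ (sup_energy K nu u < +oo)%E] /\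
    exists c1 c2 : R, 0 < c1 /\ 0 < c2 /\
      forall u, F u ->
        ((E u u)%:E <= c1%:E * sup_energy K nu u)%E /\
        (sup_energy K nu u <= c2%:E * (E u u)%:E)%E.
Proof.
move=> hK hnu; exists (form K nu), (dom K nu).
split; first exact: form_dirichlet.
split; first exact: form_regular.
split; first exact: form_strongly_local.
split; first exact: form_self_similar.
split; first by [].
exists 240, 1200; split; first by rewrite ltr0n.
split; first by rewrite ltr0n.
by move=> u du; exact: form_sup_energy.
Qed.
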